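(* Let $N\ge 1$ be an integer, let $\bar\rho=k_+k_-(q+q^{-1})^2$, and let $\bar{\mathcal A}_q^{(N)}$ be the algebra generated by the operators $\{\mathcal W_{-k}^{(N)},\mathcal W_{k+1}^{(N)},\mathcal G_{k+1}^{(N)},\tilde{\mathcal G}_{k+1}^{(N)}\mid k\in\mathbb N\}$ on $V^{(N)}$ defined recursively in the context. Then the map $$\mathsf W_{-k}\mapsto\mathcal W_{-k}^{(N)},\quad \mathsf W_{k+1}\mapsto\mathcal W_{k+1}^{(N)},\quad \mathsf G_{k+1}\mapsto\mathcal G_{k+1}^{(N)},\quad \tilde{\mathsf G}_{k+1}\mapsto\tilde{\mathcal G}_{k+1}^{(N)}\qquad(k\in\mathbb N)$$ extends to a surjective algebra homomorphism $\bar{\mathcal A}_q\to\bar{\mathcal A}_q^{(N)}$.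
   Context: $\mathbb N=\{0,1,2,\dots\}$; $\mathbb K$ is an algebraically closed field of characteristic $0$; scalars are rational functions of $q$ (with $q^{1/2}$ adjoined); $[X,Y]=XY-YX$, $[X,Y]_q=qXY-q^{-1}YX$. $\bar{\mathcal A}_q$ is the unital associative algebra with generators $\mathsf W_{-k},\mathsf W_{k+1},\mathsf G_{k+1},\tilde{\mathsf G}_{k+1}$ ($k\in\mathbb N$) and relations, for all $k,\ell\in\mathbb N$: $[\mathsf W_0,\mathsf W_{k+1}]=[\mathsf W_{-k},\mathsf W_1]=(\tilde{\mathsf G}_{k+1}-\mathsf G_{k+1})/(q+q^{-1})$; $[\mathsf W_0,\mathsf G_{k+1}]_q=[\tilde{\mathsf G}_{k+1},\mathsf W_0]_q=\bar\rho\,\mathsf W_{-k-1}$; $[\mathsf G_{k+1},\mathsf W_1]_q=[\mathsf W_1,\tilde{\mathsf G}_{k+1}]_q=\bar\rho\,\mathsf W_{k+2}$; $[\mathsf W_{-k},\mathsf W_{-\ell}]=0$; $[\mathsf W_{k+1},\mathsf W_{\ell+1}]=0$; $[\mathsf W_{-k},\mathsf W_{\ell+1}]+[\mathsf W_{k+1},\mathsf W_{-\ell}]=0$; $[\mathsf W_{-k},\mathsf G_{\ell+1}]+[\mathsf G_{k+1},\mathsf W_{-\ell}]=0$; $[\mathsf W_{-k},\tilde{\mathsf G}_{\ell+1}]+[\tilde{\mathsf G}_{k+1},\mathsf W_{-\ell}]=0$; $[\mathsf W_{k+1},\mathsf G_{\ell+1}]+[\mathsf G_{k+1},\mathsf W_{\ell+1}]=0$;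 $[\mathsf W_{k+1},\tilde{\mathsf G}_{\ell+1}]+[\tilde{\mathsf G}_{k+1},\mathsf W_{\ell+1}]=0$; $[\mathsf G_{k+1},\mathsf G_{\ell+1}]=0$; $[\tilde{\mathsf G}_{k+1},\tilde{\mathsf G}_{\ell+1}]=0$; $[\tilde{\mathsf G}_{k+1},\mathsf G_{\ell+1}]+[\mathsf G_{k+1},\tilde{\mathsf G}_{\ell+1}]=0$. $U_q(sl_2)$ has generators $S_\pm,s_3$ with $[s_3,S_\pm]=\pm S_\pm$, $[S_+,S_-]=(q^{2s_3}-q^{-2s_3})/(q-q^{-1})$. Parameters: $k_\pm\in\mathbb K$ nonzero, $\bar\epsilon_\pm\in\mathbb K$, $v_1,\dots,v_N\in\mathbb K^*$, spins $j_1,\dots,j_N$. $V_{[i]}$ is the spin-$j_i$ irreducible representation (dimension $2j_i+1$) of $U_q(sl_2)$, $V^{(N)}=V_{[N]}\otimes\cdots\otimes V_{[2]}\otimes V_{[1]}$, and $w_0^{(j)}=q^{2j+1}+q^{-2j-1}$. Set $\alpha_1=\frac{v_1^2w_0^{(j_1)}}{q+q^{-1}}+\frac{\bar\epsilon_+\bar\epsilon_-(q-q^{-1})^2}{k_+k_-(q+q^{-1})}$ and $\beta=\frac{\bar\epsilon_+\bar\epsilon_-(q-q^{-1})^2}{k_+k_-(q+q^{-1})^2}$ (i.e. $\beta$ is $\alpha_1/(q+q^{-1})$ at $v_1=0$). Initial data ($N=0$, scalars): $\mathcal W_0^{(0)}=\bar\epsilon_+$, $\mathcal W_1^{(0)}=\bar\epsilon_-$,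 $\mathcal G_1^{(0)}=\tilde{\mathcal G}_1^{(0)}=\bar\epsilon_+\bar\epsilon_-(q-q^{-1})$, and for $k\ge 1$: $\mathcal W_{-k}^{(0)}=\big(\tfrac{\alpha_1}{q+q^{-1}}\big)^{k-1}\beta\,\bar\epsilon_+$, $\mathcal W_{k+1}^{(0)}=\big(\tfrac{\alpha_1}{q+q^{-1}}\big)^{k-1}\beta\,\bar\epsilon_-$, $\mathcal G_{k+1}^{(0)}=\tilde{\mathcal G}_{k+1}^{(0)}=\big(\tfrac{\alpha_1}{q+q^{-1}}\big)^{k}\mathcal G_1^{(0)}$. Recursion for $N\ge1$, $k\ge 0$ (first tensor factor acts on $V_{[N]}$): $$\mathcal W_{-k}^{(N)}=\tfrac{q-q^{-1}}{k_-(q+q^{-1})^2}\,v_Nq^{1/2}S_+q^{s_3}\otimes\mathcal G_k^{(N-1)}+q^{2s_3}\otimes\mathcal W_{-k}^{(N-1)}-\tfrac{v_N^2}{q+q^{-1}}\mathbb I\otimes\mathcal W_{-k+1}^{(N-1)}+\tfrac{v_N^2w_0^{(j_N)}}{(q+q^{-1})^2}\mathcal W_{-k+1}^{(N)},$$ $$\mathcal W_{k+1}^{(N)}=\tfrac{q-q^{-1}}{k_+(q+q^{-1})^2}\,v_Nq^{1/2}S_-q^{-s_3}\otimes\tilde{\mathcal G}_k^{(N-1)}+q^{-2s_3}\otimes\mathcal W_{k+1}^{(N-1)}-\tfrac{v_N^2}{q+q^{-1}}\mathbb I\otimes\mathcal W_{k}^{(N-1)}+\tfrac{v_N^2w_0^{(j_N)}}{(q+q^{-1})^2}\mathcal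 W_{k}^{(N)},$$ $$\mathcal G_{k+1}^{(N)}=(q^2-q^{-2})k_-v_Nq^{-1/2}S_-q^{s_3}\otimes\mathcal W_{-k}^{(N-1)}-\tfrac{v_N^2}{q+q^{-1}}q^{2s_3}\otimes\mathcal G_k^{(N-1)}+\mathbb I\otimes\mathcal G_{k+1}^{(N-1)}+\tfrac{v_N^2w_0^{(j_N)}}{(q+q^{-1})^2}\mathcal G_k^{(N)},$$ $$\tilde{\mathcal G}_{k+1}^{(N)}=(q^2-q^{-2})k_+v_Nq^{-1/2}S_+q^{-s_3}\otimes\mathcal W_{k+1}^{(N-1)}-\tfrac{v_N^2}{q+q^{-1}}q^{-2s_3}\otimes\tilde{\mathcal G}_k^{(N-1)}+\mathbb I\otimes\tilde{\mathcal G}_{k+1}^{(N-1)}+\tfrac{v_N^2w_0^{(j_N)}}{(q+q^{-1})^2}\tilde{\mathcal G}_k^{(N)}.$$ Convention for $k=0$, at every level: in the first formula the terms $\mathcal W_{-k+1}|_{k=0}$ are $0$, in the second formula the terms $\mathcal W_k|_{k=0}$ are $0$, and $\mathcal G_0=\tilde{\mathcal G}_0=\frac{k_+k_-(q+q^{-1})^2}{q-q^{-1}}\mathbb I$. *)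

(* Defs.v *)
From HB Require Import structures.
From mathcomp Require Import all_boot all_order all_algebra.
From mathcomp Require Import generic_quotient ring_quotient boolp mxtens.
From mathcomp Require Import ring.
From mathcomp.multinomials Require Import monalg.

Set Implicit Arguments.
Unset Strict Implicit.
Unset Printing Implicit Defensive.

Import GRing.Theory.
Local Open Scope ring_scope.
Local Open Scope quotient_scope.

(* W_{-k}, W_{k+1}, G_{k+1}, Gtilde_{k+1} for k in nat. *)
Record op_family (A : Type) := Family {
  Wn : nat -> A;  (* Wn k  = W_{-k}         *)
  Wp : nat -> A;  (* Wp k  = W_{k+1}        *)
  Gp : nat -> A;  (* Gp k  = G_{k+1}        *)
  Gt : nat -> A   (* Gt k  = Gtilde_{k+1}   *)
}.

Section Relators.
Variables (F : fieldType) (A : lalgType F) (q rho : F).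

Definition comm (x y : A) : A := x * y - y * x.
Definition qcomm (x y : A) : A := q *: (x * y) - q^-1 *: (y * x).

(* Differences of the two sides of the defining relations of index k, l. *)
Definition relators (f : op_family A) (k l : nat) : seq A :=
  let: Family wn wp g gt := f in
  let x := (q + q^-1)^-1 *: (gt k - g k) in
  [:: comm (wn 0) (wp k) - x;
      comm (wn k) (wp 0) - x;
      qcomm (wn 0) (g k) - rho *: wn k.+1;
      qcomm (gt k) (wn 0) - rho *: wn k.+1;
      qcomm (g k) (wp 0) - rho *: wp k.+1;
      qcomm (wp 0) (gt k) - rho *: wp k.+1;
      comm (wn k) (wn l);
      comm (wp k) (wp l);
      comm (wn k) (wp l) + comm (wp k) (wn l);
      comm (wn k) (g l) + comm (g k) (wn l);
      comm (wn k) (gt l) + comm (gt k) (wn l);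
      comm (wp k) (g l) + comm (g k) (wp l);
      comm (wp k) (gt l) + comm (gt k) (wp l);
      comm (g k) (g l);
      comm (gt k) (gt l);
      comm (gt k) (g l) + comm (g k) (gt l)].
Lemma relators_eq0 (c : A -> F) (f : op_family A) k l :
  (forall a b, c (a + b) = c a + c b) -> (forall a, c (- a) = - c a) ->
  (forall t a, c (t *: a) = t * c a) -> (forall a b, c (a * b) = c a * c b) ->
  (forall m, [/\ c (Wn f m) = 0, c (Wp f m) = 0, c (Gp f m) = 0 & c (Gt f m) = 0]) ->
  {in relators f k l, forall x, c x = 0}.
Proof.
move=> cD cN cZ cM; case: f => wn wp g gt /= c0.
have cwn m : c (wn m) = 0 by case: (c0 m).
have cwp m : c (wp m) = 0 by case: (c0 m).
have cg m : c (g m) = 0 by case: (c0 m).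
have cgt m : c (gt m) = 0 by case: (c0 m).
suff /allP h : all (fun x => c x == 0) (relators (Family wn wp g gt) k l).
  by move=> x /h /eqP.
rewrite /= /comm /qcomm !(cD, cN, cZ, cM) !(cwn, cwp, cg, cgt).
by rewrite !(mulr0, subrr, addr0) eqxx.
Qed.

End Relators.

Inductive in_ideal (A : pzRingType) (X : A -> Prop) : A -> Prop :=
| in_ideal_gen x : X x -> in_ideal X x
| in_ideal0 : in_ideal X 0
| in_idealD x y : in_ideal X x -> in_ideal X y -> in_ideal X (x + y)
| in_idealMl a x : in_ideal X x -> in_ideal X (a * x)
| in_idealMr x a : in_ideal X x -> in_ideal X (x * a).

Inductive in_subalg (F : fieldType) (A : algType F) (X : A -> Prop) : A -> Prop :=
| in_subalg_gen x : X x -> in_subalg X x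
| in_subalg0 : in_subalg X 0
| in_subalg1 : in_subalg X 1
| in_subalgD x y : in_subalg X x -> in_subalg X y -> in_subalg X (x + y)
| in_subalgZ a x : in_subalg X x -> in_subalg X (a *: x)
| in_subalgM x y : in_subalg X x -> in_subalg X y -> in_subalg X (x * y).

Section GeneratedSubalgebra.
Variables (F : fieldType) (A : algType F) (X : A -> Prop).

Definition subalg_pred : pred A := fun x => `[< in_subalg X x >].

Fact subalg_pred_closed : GRing.subsemialg_closed subalg_pred.
Proof.
split.
- exact/asboolP/in_subalg1.
- split=> [|x y /asboolP hx /asboolP hy]; first exact/asboolP/in_subalg0.
  exact/asboolP/in_subalgD.
- by move=> a x /asboolP hx; apply/asboolP/in_subalgZ.
- by move=> x y /asboolP hx /asboolP hy; apply/asboolP/in_subalgM.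
Qed.

HB.instance Definition _ :=
  GRing.isSubalgClosed.Build F A subalg_pred subalg_pred_closed.

(* The subalgebra of A generated by X, as an algebra. *)
Definition gen_subalg := {x : A | subalg_pred x}.
HB.instance Definition _ := SubChoice.on gen_subalg.
HB.instance Definition _ := [SubChoice_isSubAlgebra of gen_subalg by <:].

End GeneratedSubalgebra.

Inductive gen := gWn of nat | gWp of nat | gGp of nat | gGt of nat.

Definition gen_code (x : gen) : 'I_4 * nat :=
  match x with
  | gWn k => (inord 0, k) | gWp k => (inord 1, k)
  | gGp k => (inord 2, k) | gGt k => (inord 3, k)
  end.
Definition gen_decode (c : 'I_4 * nat) : gen :=
  match val c.1 with
  | 0 => gWn c.2 | 1 => gWp c.2 | 2 => gGp c.2 | _ => gGt c.2
  end.
Fact gen_codeK : cancel gen_code gen_decode.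
Proof. by case=> k; rewrite /gen_decode /= inordK. Qed.
HB.instance Definition _ := Countable.copy gen (can_type gen_codeK).

Lemma malg_scaleAr (F : fieldType) (M : monomType) (a : F) (x y : {malg F[M]}) :
  a *: (x * y) = x * (a *: y).
Proof.
have C z : @malgC M F a * z = z * @malgC M F a.
  rewrite mul_malgC malgZ_def malgM_def fgmulgU.
  by apply/eq_bigr=> k _; rewrite mulm1 mulrC.
by rewrite -(mul_malgC a (x * y)) -(mul_malgC a y) (mulrA x) -(C x) mulrA.
Qed.

(* The algebra with the given presentation: the free algebra on the
   generators modulo the two-sided ideal generated by the relators. *)
Section Abar.
Variables (F : fieldType) (q rho : F).

Definition free_alg := {malg F[{fmonom gen}]}.
HB.instance Definition _ := GRing.Lalgebra.on free_alg.

Definition free_gens : op_family free_alg :=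
  Family (fun k => << fmu (gWn k) >>) (fun k => << fmu (gWp k) >>)
         (fun k => << fmu (gGp k) >>) (fun k => << fmu (gGt k) >>).

Definition is_relator (x : free_alg) : Prop :=
  exists k l, x \in relators q rho free_gens k l.

Definition rel_ideal : {pred free_alg} := fun x => `[< in_ideal is_relator x >].

Fact rel_ideal_closed : zmod_closed rel_ideal.
Proof.
split=> [|x y /asboolP hx /asboolP hy]; first exact/asboolP/in_ideal0.
by apply/asboolP/in_idealD=> //; rewrite -mulN1r; apply: in_idealMl.
Qed.
HB.instance Definition _ :=
  GRing.isZmodClosed.Build free_alg rel_ideal rel_ideal_closed.

Definition Abar := Quotient.quot rel_ideal.
HB.instance Definition _ := GRing.Zmodule.on Abar.

Definition Abar_pi (x : free_alg) : Abar := \pi x.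
Local Notation pi := Abar_pi.

Lemma Abar_ind (P : Abar -> Prop) : (forall a, P (pi a)) -> forall x, P x.
Proof. exact: quotW. Qed.

Lemma Abar_piP (x y : free_alg) :
  reflect (pi x = pi y) (x - y \in rel_ideal).
Proof. by rewrite (@Quotient.idealrBE free_alg rel_ideal); apply: eqP. Qed.

Definition Abar_one : Abar := pi 1.
Definition Abar_mul (x y : Abar) : Abar := pi (repr x * repr y).
Definition Abar_scale (a : F) (x : Abar) : Abar := pi (a *: repr x).

Lemma pi_sub_repr (x : free_alg) : x - repr (pi x) \in rel_ideal.
Proof. by apply/Abar_piP; rewrite /pi reprK. Qed.

Lemma Abar_piM (x y : free_alg) : Abar_mul (pi x) (pi y) = pi (x * y).
Proof.
apply/esym/Abar_piP.
have -> : x * y - repr (pi x) * repr (pi y) =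
   (x - repr (pi x)) * y + repr (pi x) * (y - repr (pi y)).
  by rewrite mulrBl mulrBr addrA addrNK.
have /asboolP hx := pi_sub_repr x; have /asboolP hy := pi_sub_repr y.
by apply/asboolP/in_idealD; [apply: in_idealMr | apply: in_idealMl].
Qed.

Lemma Abar_piZ a (x : free_alg) : Abar_scale a (pi x) = pi (a *: x).
Proof.
apply/esym/Abar_piP; rewrite -scalerBr -mul_malgC.
by have /asboolP hx := pi_sub_repr x; apply/asboolP/in_idealMl.
Qed.

Lemma Abar_piD (x y : free_alg) : pi x + pi y = pi (x + y).
Proof. exact/esym/(@Quotient.pi_add free_alg rel_ideal). Qed.

Fact Abar_mulA : associative Abar_mul.
Proof.
elim/Abar_ind=> x; elim/Abar_ind=> y; elim/Abar_ind=> z.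
by rewrite !Abar_piM mulrA.
Qed.
Fact Abar_mul1l : left_id Abar_one Abar_mul.
Proof. by move=> x; elim/Abar_ind: x => x; rewrite Abar_piM mul1r. Qed.
Fact Abar_mul1r : right_id Abar_one Abar_mul.
Proof. by move=> x; elim/Abar_ind: x => x; rewrite Abar_piM mulr1. Qed.
Fact Abar_mulDl : left_distributive Abar_mul +%R.
Proof.
elim/Abar_ind=> x; elim/Abar_ind=> y; elim/Abar_ind=> z.
by rewrite !(Abar_piM, Abar_piD) mulrDl.
Qed.
Fact Abar_mulDr : right_distributive Abar_mul +%R.
Proof.
elim/Abar_ind=> x; elim/Abar_ind=> y; elim/Abar_ind=> z.
by rewrite !(Abar_piM, Abar_piD) mulrDr.
Qed.

Local Notation coef1 := (@mcoeff {fmonom gen} F mone).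

(* The ideal is proper: the relators have zero constant term. *)
Lemma rel_ideal_coef1 (x : free_alg) : x \in rel_ideal -> coef1 x = 0.
Proof.
have cM (a b : free_alg) : coef1 (a * b) = coef1 a * coef1 b.
  exact: rmorphM.
have cU g : coef1 (<< fmu g >> : free_alg) = 0.
  by rewrite mcoeffU1 fmP fmU fm1.
move=> /asboolP; elim=> {x}.
- move=> x [k [l]]; apply: relators_eq0 => //.
  + exact: mcoeffD.
  + exact: mcoeffN.
  + by move=> t a; apply: mcoeffZ.
  + by move=> m; split; apply: cU.
- exact: mcoeff0.
- by move=> x y _ hx _ hy; rewrite mcoeffD hx hy addr0.
- by move=> a x _ hx; rewrite cM hx mulr0.
- by move=> x a _ hx; rewrite cM hx mul0r.
Qed.

Fact Abar_nonzero1 : Abar_one != 0.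
Proof.
have pi0 : pi 0 = 0 by apply: (addrI (pi 0)); rewrite Abar_piD !addr0.
rewrite -pi0; apply/eqP=> /Abar_piP /rel_ideal_coef1.
have -> : coef1 (1 - 0 : free_alg) = 1 by rewrite subr0 mcoeff1 eqxx.
by move/eqP; rewrite oner_eq0.
Qed.

HB.instance Definition _ := GRing.Zmodule_isNzRing.Build Abar
  Abar_mulA Abar_mul1l Abar_mul1r Abar_mulDl Abar_mulDr Abar_nonzero1.

Fact Abar_scaleA a b (x : Abar) :
  Abar_scale a (Abar_scale b x) = Abar_scale (a * b) x.
Proof. by elim/Abar_ind: x => x; rewrite !Abar_piZ scalerA. Qed.
Fact Abar_scale1 : left_id 1 Abar_scale.
Proof. by move=> x; elim/Abar_ind: x => x; rewrite Abar_piZ scale1r. Qed.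
Fact Abar_scaleDr : right_distributive Abar_scale +%R.
Proof.
by move=> a x y; elim/Abar_ind: x => x; elim/Abar_ind: y => y; rewrite !(Abar_piZ, Abar_piD) scalerDr.
Qed.
Fact Abar_scaleDl (x : Abar) : {morph Abar_scale^~ x : a b / a + b}.
Proof.
by move=> a b; elim/Abar_ind: x => x; rewrite !(Abar_piZ, Abar_piD) scalerDl.
Qed.
HB.instance Definition _ := GRing.Zmodule_isLmodule.Build F Abar
  Abar_scaleA Abar_scale1 Abar_scaleDr Abar_scaleDl.

Fact Abar_scaleAl (a : F) (x y : Abar) : a *: (x * y) = (a *: x) * y.
Proof.
elim/Abar_ind: x => x; elim/Abar_ind: y => y; change (Abar_scale a (Abar_mul (pi x)
  (pi y)) = Abar_mul (Abar_scale a (pi x)) (pi y)).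
by rewrite !(Abar_piM, Abar_piZ) -scalerAl.
Qed.
HB.instance Definition _ := GRing.Lmodule_isLalgebra.Build F Abar Abar_scaleAl.

Fact Abar_scaleAr (a : F) (x y : Abar) : a *: (x * y) = x * (a *: y).
Proof.
elim/Abar_ind: x => x; elim/Abar_ind: y => y; change (Abar_scale a (Abar_mul (pi x)
  (pi y)) = Abar_mul (pi x) (Abar_scale a (pi y))).
by rewrite !(Abar_piM, Abar_piZ) malg_scaleAr.
Qed.
HB.instance Definition _ := GRing.Lalgebra_isAlgebra.Build F Abar Abar_scaleAr.

Definition Abar_gens : op_family Abar :=
  Family (fun k => pi (Wn free_gens k)) (fun k => pi (Wp free_gens k))
         (fun k => pi (Gp free_gens k)) (fun k => pi (Gt free_gens k)).

End Abar.

(* Rational functions over K in the variable q^{1/2}. *)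
Notation scalars K := {fraction {poly K}}.

Lemma qnum_identity (F : fieldType) (q x y : F) :
  q != 0 -> x != 0 -> y != 0 -> q - q^-1 != 0 ->
  (x - x^-1) / (q - q^-1) * ((q * y - (q * y)^-1) / (q - q^-1))
    - (y - y^-1) / (q - q^-1) * ((q * x - (q * x)^-1) / (q - q^-1))
  = (q - q^-1)^-1 * (x / y - y / x).
Proof.
move=> q0 x0 y0 d0; rewrite !invfM.
have -> : (x - x^-1) / (q - q^-1) * ((q * y - q^-1 / y) / (q - q^-1)) -
  (y - y^-1) / (q - q^-1) * ((q * x - q^-1 / x) / (q - q^-1)) =
  (q - q^-1)^-1 * ((q - q^-1)^-1 * ((x - x^-1) * (q * y - q^-1 / y) -
  (y - y^-1) * (q * x - q^-1 / x))) by ring.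
congr (_ * _); apply: (mulfI d0); rewrite mulrA divff // mul1r.
by field; rewrite q0 x0 y0.
Qed.

Section Spin.
Variable K : closedFieldType.
Local Notation F := (scalars K).

Definition cst (c : K) : F := tofrac c%:P.
Definition qh : F := tofrac 'X. (* q^{1/2} *)
Definition q : F := qh ^+ 2.

Definition qnum (m : nat) : F := (q ^+ m - q ^- m) / (q - q^-1).

(* The irreducible representation of spin j = n/2, in a basis e_0, ..., e_n of
   weight vectors: s_3 e_a = (n/2 - a) e_a.  Matrices act on column vectors. *)
Section Rep.
Variable n : nat.

Definition s3 : 'M[F]_n.+1 := diag_mx (\row_a (n%:R / 2%:R - a%:R)).

(* q^{m s_3} *)
Definition qs3 (m : int) : 'M[F]_n.+1 :=
  diag_mx (\row_a qh ^ (m * (n%:Z - (2 * a)%:Z))).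

(* S_+ e_b = [n + 1 - b] e_{b-1} *)
Definition Splus : 'M[F]_n.+1 :=
  \matrix_(a, b) if b == a.+1 :> nat then qnum (n - a) else 0.

(* S_- e_b = [b + 1] e_{b+1} *)
Definition Sminus : 'M[F]_n.+1 :=
  \matrix_(a, b) if a == b.+1 :> nat then qnum a else 0.

Lemma qh_neq0 : qh != 0.
Proof. by rewrite tofrac_eq0 polyX_eq0. Qed.

Lemma qhX_neq1 m : (0 < m)%N -> qh ^+ m != 1.
Proof.
move=> m0; rewrite -tofracXn -tofrac1 tofrac_eq; apply/eqP=> /(congr1 (size \o polyseq)).
by rewrite /= size_polyXn size_poly1; case: m m0.
Qed.

Lemma qXB_neq0 m : (0 < m)%N -> q ^+ m - q ^- m != 0.
Proof.
move=> m0; have qm0 : q ^+ m != 0 by rewrite !expf_neq0 ?qh_neq0.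
rewrite subr_eq0; apply/eqP=> /(congr1 (fun x => x * q ^+ m)).
rewrite mulVf // -expr2 -!exprM; apply/eqP/qhX_neq1.
by rewrite !muln_gt0 m0.
Qed.

Lemma qnum_neq0 m : (0 < m)%N -> qnum m != 0.
Proof.
by move=> m0; rewrite mulf_neq0 ?invr_neq0 ?qXB_neq0 // -(expr1 q) qXB_neq0.
Qed.

Lemma s3_Splus : s3 *m Splus - Splus *m s3 = Splus.
Proof.
apply/matrixP=> a b; rewrite mul_diag_mx mul_mx_diag !mxE.
case: eqP=> [->|_]; last by rewrite mul0r mulr0 subrr.
by rewrite -natr1; ring.
Qed.

Lemma s3_Sminus : s3 *m Sminus - Sminus *m s3 = - Sminus.
Proof.
apply/matrixP=> a b; rewrite mul_diag_mx mul_mx_diag !mxE.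
case: eqP=> [->|_]; last by rewrite mul0r mulr0 subrr oppr0.
by rewrite -natr1; ring.
Qed.

Lemma Splus_Sminus :
  Splus *m Sminus - Sminus *m Splus = (q - q^-1)^-1 *: (qs3 2 - qs3 (- 2)).
Proof.
have q0 : q != 0 by rewrite expf_neq0 ?qh_neq0.
have dq : q - q^-1 != 0 by rewrite -(expr1 q) qXB_neq0.
have qn0 : qnum 0 = 0 by rewrite /qnum expr0 invr1 subrr mul0r.
have ps a b : (Splus *m Sminus) a b = (qnum (n - a) * qnum a.+1) *+ (a == b).
  rewrite mxE; have [an|an] := ltnP a n; last first.
    rewrite big1 => [|k _]; last first.
      rewrite !mxE; case: eqP=> [e|_]; last by rewrite mul0r.
      by move: (ltn_ord k); rewrite e ltnS ltnNge an.
    by rewrite (_ : n - a = 0)%N ?qn0 ?mul0r ?mul0rn //; apply/eqP; rewrite subn_eq0.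
  rewrite (bigD1 (Ordinal (an : a.+1 < n.+1)%N)) //= big1 => [|k kn].
    rewrite !mxE eqxx eqSS addr0 -val_eqE /=.
    by case: eqP=> // _; rewrite mulr0.
  rewrite !mxE; case: eqP=> [e|_]; last by rewrite mul0r.
  by case/eqP: kn; apply: val_inj.
have ms a b : (Sminus *m Splus) a b = (qnum a * qnum (n - a).+1) *+ (a == b).
  rewrite mxE; case: a => [[|a] ha].
    rewrite big1 => [|k _]; last by rewrite !mxE mul0r.
    by rewrite qn0 mul0r mul0rn.
  rewrite (bigD1 (Ordinal (ltnW ha))) //= big1 => [|k kn].
    rewrite !mxE /= eqxx addr0 -val_eqE /= eq_sym subnSK //.
    by case: eqP=> // _; rewrite mulr0.
  rewrite !mxE; case: eqP=> [[e]|_]; last by rewrite mul0r.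
  by case/eqP: kn; apply: val_inj.
apply/matrixP=> a b; rewrite mxE [X in _ + X]mxE ps ms !mxE.
case: eqP=> [_|_]; last by rewrite !mulr0n subrr mulr0.
rewrite !mulr1n /qnum.
have an : (a <= n)%N by rewrite -ltnS.
have E1 : qh ^ (2 * (n%:Z - (2 * a)%:Z)) = q ^+ (n - a) / q ^+ a.
  rewrite /q -!exprM !exprnP invr_expz -expfzDr ?qh_neq0 //.
  by congr (_ ^ _); rewrite !PoszM -!subzn //; ring.
have E2 : qh ^ (- 2 * (n%:Z - (2 * a)%:Z)) = q ^+ a / q ^+ (n - a).
  rewrite /q -!exprM !exprnP invr_expz -expfzDr ?qh_neq0 //.
  by congr (_ ^ _); rewrite !PoszM -!subzn //; ring.
rewrite E1 E2 !exprS.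
exact: (qnum_identity q0 (expf_neq0 _ q0) (expf_neq0 _ q0) dq).
Qed.

(* A row of W is a transposed vector: the subspaces stable under S_+ and S_-
   are trivial. *)
Lemma spin_irreducible (W : 'M[F]_n.+1) :
  stablemx W Splus^T -> stablemx W Sminus^T -> W != 0 -> row_full W.
Proof.
move=> WP WM W0.
have up (u : 'rV_n.+1) : (u <= W)%MS -> (u *m Splus^T <= W)%MS.
  by move=> uW; apply: submx_trans WP; apply: submxMr.
have down (u : 'rV_n.+1) : (u <= W)%MS -> (u *m Sminus^T <= W)%MS.
  by move=> uW; apply: submx_trans WM; apply: submxMr.
have upE (u : 'rV_n.+1) (a b : 'I_n.+1) : b = a.+1 :> nat ->
    (u *m Splus^T) 0 a = u 0 b * qnum (n - a).
  move=> ba; rewrite mxE (bigD1 b) //= big1 => [|k kb].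
    by rewrite !mxE ba eqxx addr0.
  rewrite !mxE; case: eqP=> [e|_]; last by rewrite mulr0.
  by case/eqP: kb; apply: val_inj; rewrite /= e ba.
have upE0 (u : 'rV_n.+1) (a : 'I_n.+1) m : (forall b : 'I_n.+1, (m < b)%N -> u 0 b = 0) ->
    (m <= a)%N -> (u *m Splus^T) 0 a = 0.
  move=> u0 ma; rewrite mxE big1 // => k _; rewrite !mxE.
  case: eqP=> [e|_]; last by rewrite mulr0.
  by rewrite u0 ?mul0r // e ltnS.
have e0W : ((delta_mx 0 ord0 : 'rV[F]_n.+1) <= W)%MS.
  suff ind m : (m <= n)%N -> forall u : 'rV_n.+1, (u <= W)%MS -> u != 0 ->
      (forall b : 'I_n.+1, (m < b)%N -> u 0 b = 0) -> ((delta_mx 0 ord0 : 'rV[F]_n.+1) <= W)%MS.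
    have /rowV0Pn [u uW u0] := W0.
    by apply: (ind n (leqnn n) u uW u0) => b; rewrite ltnNge -ltnS ltn_ord.
  elim: m => [_|m IH mn] u uW u0 uz.
    have uE : u = u 0 ord0 *: delta_mx 0 ord0.
      apply/rowP=> b; rewrite !mxE /= -val_eqE /=; case: posnP=> [b0|b0].
        by rewrite mulr1; congr (u _ _); apply: val_inj.
      by rewrite mulr0 uz.
    have c0 : u 0 ord0 != 0.
      by apply: contraNneq u0 => c0; rewrite uE c0 scale0r.
    by move: uW; rewrite uE (eqmx_scale _ c0).
  pose b1 : 'I_n.+1 := Ordinal (mn : (m.+1 < n.+1)%N).
  pose a1 : 'I_n.+1 := Ordinal (ltnW mn : (m < n.+1)%N).
  have [c0|c0] := eqVneq (u 0 b1) 0.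
    apply: (IH (ltnW mn) u uW u0) => b; rewrite leq_eqVlt => /predU1P[e|/uz//].
    by rewrite -c0; congr (u _ _); apply: val_inj.
  apply: (IH (ltnW mn) _ (up u uW)) => [|b mb]; last exact: upE0 uz mb.
  apply: contraNneq c0 => /rowP/(_ a1)/eqP; rewrite (upE u a1 b1) // mxE.
  by rewrite mulf_eq0 (negPf (qnum_neq0 _)) ?orbF // subn_gt0.
have eW k (hk : (k < n.+1)%N) : ((delta_mx 0 (Ordinal hk) : 'rV[F]_n.+1) <= W)%MS.
  elim: k hk => [|k IH] hk.
    by rewrite (_ : Ordinal hk = ord0) //; apply: val_inj.
  have hk' := ltnW hk; have := down _ (IH hk').
  rewrite -rowE (_ : row _ _ = qnum k.+1 *: delta_mx 0 (Ordinal hk)).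
    by rewrite (eqmx_scale _ (qnum_neq0 (ltn0Sn k))).
  apply/rowP=> a; rewrite !mxE /= -val_eqE /=.
  by case: eqP=> [->|_]; rewrite ?mulr1 ?mulr0.
by rewrite -sub1mx; apply/row_subP=> i; rewrite row1; case: i.
Qed.
End Rep.
End Spin.

Section Operators.
Variables (K : closedFieldType) (kp km ep em : K) (v : nat -> K).
(* twoj i = 2 j_i, so that V_[i] has dimension (twoj i).+1. *)
Variable twoj : nat -> nat.
Local Notation F := (scalars K).
Local Notation q := (q K).
Local Notation qh := (qh K).

Definition rho_bar : F := cst kp * cst km * (q + q^-1) ^+ 2.

(* The value of G_0 and Gtilde_0. *)
Definition G0 : F := rho_bar / (q - q^-1).

Definition w0 (n : nat) : F := q ^+ n.+1 + q ^- n.+1.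

Definition alpha1 : F :=
  cst (v 1) ^+ 2 * w0 (twoj 1) / (q + q^-1)
  + cst ep * cst em * (q - q^-1) ^+ 2 / (cst kp * cst km * (q + q^-1)).

Definition beta : F :=
  cst ep * cst em * (q - q^-1) ^+ 2 / (cst kp * cst km * (q + q^-1) ^+ 2).

Definition init_ops : op_family 'M[F]_1 :=
  let r := alpha1 / (q + q^-1) in
  let g1 := cst ep * cst em * (q - q^-1) in
  Family (fun k => (if k is i.+1 then r ^+ i * beta * cst ep else cst ep)%:M)
         (fun k => (if k is i.+1 then r ^+ i * beta * cst em else cst em)%:M)
         (fun k => (r ^+ k * g1)%:M)
         (fun k => (r ^+ k * g1)%:M).

(* One step of the recursion, from operators f on F^dim to operators on the
   tensor product of the spin n/2 representation with F^dim. *)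
Section Dressing.
Variables (n : nat) (vN : K) (dim : nat) (f : op_family 'M[F]_dim).
Local Notation u := (cst vN).
Local Notation Sp := (Splus K n).
Local Notation Sm := (Sminus K n).
Local Notation qs := (qs3 K n).
Local Notation Id := (1%:M : 'M[F]_n.+1).
Local Notation c := (u ^+ 2 * w0 n / (q + q^-1) ^+ 2).
Local Notation prev g z k := (if k is i.+1 then g i else z).

Fixpoint dress_Wn (k : nat) : 'M[F]_(n.+1 * dim) :=
  ((q - q^-1) / (cst km * (q + q^-1) ^+ 2) * u * qh)
      *: ((Sp *m qs 1) *t prev (Gp f) G0%:M k)
  + qs 2 *t Wn f k
  - (u ^+ 2 / (q + q^-1)) *: (Id *t prev (Wn f) 0 k)
  + c *: prev dress_Wn 0 k.

Fixpoint dress_Wp (k : nat) : 'M[F]_(n.+1 * dim) :=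
  ((q - q^-1) / (cst kp * (q + q^-1) ^+ 2) * u * qh)
      *: ((Sm *m qs (- 1)) *t prev (Gt f) G0%:M k)
  + qs (- 2) *t Wp f k
  - (u ^+ 2 / (q + q^-1)) *: (Id *t prev (Wp f) 0 k)
  + c *: prev dress_Wp 0 k.

Fixpoint dress_Gp (k : nat) : 'M[F]_(n.+1 * dim) :=
  ((q ^+ 2 - q ^- 2) * cst km * u * qh^-1) *: ((Sm *m qs 1) *t Wn f k)
  - (u ^+ 2 / (q + q^-1)) *: (qs 2 *t prev (Gp f) G0%:M k)
  + Id *t Gp f k
  + c *: prev dress_Gp G0%:M k.

Fixpoint dress_Gt (k : nat) : 'M[F]_(n.+1 * dim) :=
  ((q ^+ 2 - q ^- 2) * cst kp * u * qh^-1) *: ((Sp *m qs (- 1)) *t Wp f k)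
  - (u ^+ 2 / (q + q^-1)) *: (qs (- 2) *t prev (Gt f) G0%:M k)
  + Id *t Gt f k
  + c *: prev dress_Gt G0%:M k.

Definition dress : op_family 'M[F]_(n.+1 * dim) :=
  Family dress_Wn dress_Wp dress_Gp dress_Gt.
End Dressing.

(* (pred_dim N).+1 is the dimension of V^(N): it is convertible to
   (twoj N).+1 * ... * (twoj 1).+1 * 1 for concrete N, and has the successor
   form required by the algebra structure of square matrices. *)
Fixpoint pred_dim (N : nat) : nat :=
  if N is M.+1 then (pred_dim M + twoj N * (pred_dim M).+1)%N else 0%N.

Lemma pred_dimE N : (pred_dim N).+1 = (\prod_(1 <= i < N.+1) (twoj i).+1)%N.
Proof.
elim: N => [|N IH]; first by rewrite big_geq.
by rewrite big_nat_recr //= -IH [RHS]mulnC mulSn addSn.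
Qed.

Fixpoint ops (N : nat) : op_family 'M[F]_((pred_dim N).+1) :=
  match N with
  | 0 => init_ops
  | M.+1 => dress (twoj M.+1) (v M.+1) (ops M)
  end.

Definition op_gens (N : nat) (x : 'M[F]_((pred_dim N).+1)) : Prop :=
  exists k, [\/ x = Wn (ops N) k, x = Wp (ops N) k,
                x = Gp (ops N) k | x = Gt (ops N) k].

Definition AbarN (N : nat) := gen_subalg (@op_gens N).
HB.instance Definition _ N := GRing.Algebra.on (AbarN N).
HB.instance Definition _ N := SubChoice.on (AbarN N).

End Operators.

(* Main.v *)
Require Import Defs.
From HB Require Import structures.
From mathcomp Require Import all_boot all_order all_algebra.
From mathcomp Require Import generic_quotient boolp mxtens.
From mathcomp Require Import ring zify.
From mathcomp.multinomials Require Import monalg.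

Set Implicit Arguments.
Unset Strict Implicit.
Unset Printing Implicit Defensive.

Import GRing.Theory.
Local Open Scope ring_scope.

(* Let W(z), V(z), G(z), T(z) be the generating functions of W_{-k}, W_{k+1},
   G_k, Gtilde_k (k >= 0, with the scalars G_0 and Gtilde_0).  The defining
   relations are coefficients of homogeneous quadratic exchange relations
   between (W, V, G, T)(z) and (W, V, G, T)(w).  Up to the factor 1 - c z, with
   c the coefficient of the last term of the recursion, one step of the
   recursion is a linear transformation of (W, V, G, T), polynomial in z, which
   preserves the exchange relations by the relations of U_q(sl_2) alone; by
   homogeneity the scalar factor is harmless.  For N = 0 the generating
   functions are one scalar series times constants.  So, up to scalar series, all
   is polynomial in z and w, and the exchange relations can be checked at the
   points z <> w of the field, where z - w is invertible. *)

(* A quadruple of operators (W, V, G, T), the values at one point of the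
   generating functions of W_{-k}, W_{k+1}, G_k and Gtilde_k. *)
Notation quad A := ((A * A) * (A * A))%type.
Notation qW x := x.1.1.
Notation qV x := x.1.2.
Notation qG x := x.2.1.
Notation qT x := x.2.2.

Definition quad_swap A (x : quad A) : quad A := ((qV x, qW x), (qT x, qG x)).

(** Nonvanishing of [q - q^-1] in the shape that [field] asks for after clearing [q^-1]. *)
Lemma sqrB1_neq0 (F : fieldType) (q : F) :
  q != 0 -> q - q^-1 != 0 -> q * q - 1 != 0.
Proof.
move=> q0; apply: contraNneq => qq.
by rewrite -[q - q^-1](mulfK q0) mulrBl mulVf // qq mul0r.
Qed.

Lemma sqrD1_neq0 (F : fieldType) (q : F) :
  q != 0 -> q + q^-1 != 0 -> q * q + 1 != 0.
Proof.
move=> q0; apply: contraNneq => qq.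
by rewrite -[q + q^-1](mulfK q0) mulrDl mulVf // qq mul0r.
Qed.

(** * Exchange relations between values at two points, and one dressing step on values *)

Section Exchange.
Variables (F : fieldType) (q t : F).

(** Denominators [z - w] are cleared, so each relation is polynomial in [z] and [w]. The constant
    [t] carries the normalization of [rho]: in the application [q * t = rho * (q + q^-1)]. *)
Definition half_exchange d (z w : F) (x y : quad 'M[F]_d) : Prop :=
  [/\ qW x *m qW y = qW y *m qW x,
      qG x *m qG y = qG y *m qG x,
      (z - w) *: (qW x *m qG y) =
        (z - q ^- 2 * w) *: (qG y *m qW x) - (w * (1 - q ^- 2)) *: (qG x *m qW y)
    & [/\ (z - w) *: (qW x *m qT y) =
            (z - q ^+ 2 * w) *: (qT y *m qW x) - (w * (1 - q ^+ 2)) *: (qT x *m qW y),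
          (q * t * (z - w)) *: (qW x *m qV y - qV y *m qW x) =
            (q - q^-1) *: (qG y *m qT x - qG x *m qT y)
        & (z - w) *: (qT x *m qG y - qG y *m qT x) =
            - (q * t * (q - q^-1) * z * w) *: (qV x *m qW y - qV y *m qW x)]].

(** Closure of the six relations under exchange of the two points and under the symmetry W <-> V, G
    <-> T of the presentation. *)
Definition exchange d (z w : F) (x y : quad 'M[F]_d) : Prop :=
  [/\ half_exchange z w x y,
      half_exchange w z y x,
      half_exchange z w (quad_swap x) (quad_swap y)
    & half_exchange w z (quad_swap y) (quad_swap x)].

Lemma exchange_sym d z w (x y : quad 'M[F]_d) :
  exchange z w x y -> exchange w z y x.
Proof. by case. Qed.

Lemma exchange_swap d z w (x y : quad 'M[F]_d) :
  exchange z w x y -> exchange z w (quad_swap x) (quad_swap y).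
Proof. by case: x => [[? ?] [? ?]]; case: y => [[? ?] [? ?]]; case. Qed.

Section Dressing.
Variables (n d : nat) (s : F).

(* The elements, up to scalars, S_+ q^{s_3}, S_+ q^{-s_3}, S_- q^{s_3},
   S_- q^{-s_3}, q^{2 s_3}, q^{-2 s_3}. *)
Record borel_pairs : Type := BorelPairs {
  bE1 : 'M[F]_n; bE2 : 'M[F]_n; bF1 : 'M[F]_n; bF2 : 'M[F]_n;
  bK : 'M[F]_n; bL : 'M[F]_n }.

(** Up to scalars, the involution of U_q(sl_2) that exchanges S_+ with S_- and inverts q^{s_3}. *)
Definition borel_swap (b : borel_pairs) :=
  BorelPairs (bF2 b) (bF1 b) (bE2 b) (bE1 b) (bL b) (bK b).

(** For [s = a b t / (q - q^-1)^2] this is [a b / (q (q - q^-1))], the coefficient of [K - L] in the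
    commutator of [a S_+ q^{s_3}] and [b S_- q^{-s_3}]. *)
Definition nu := s * (q - q^-1) / (q * t).

(** The products met when [half_exchange] is expanded after dressing, oriented as rewriting rules
    towards a normal order with F to the left of E. *)
Definition half_borel (b : borel_pairs) : Prop :=
  let: BorelPairs E1 E2 F1 F2 K L := b in
  [/\ [/\ K *m L = 1%:M, L *m K = 1%:M, K *m E1 = q ^+ 2 *: (E1 *m K)
        & K *m F1 = q ^- 2 *: (F1 *m K)],
      [/\ K *m E2 = q ^+ 2 *: E1, E2 *m K = E1, L *m E1 = q ^- 2 *: E2
        & E1 *m L = E2],
      [/\ K *m F2 = q ^- 2 *: F1, F2 *m K = F1, L *m F1 = q ^+ 2 *: F2
        & F1 *m L = F2]
    & [/\ E1 *m E2 = q ^+ 2 *: (E2 *m E1), F1 *m E2 = q ^+ 2 *: (F2 *m E1),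
          E1 *m F2 = F2 *m E1 + nu *: (K - L),
          E2 *m F1 = q ^+ 2 *: (F2 *m E1) + (q ^+ 2 * nu) *: (K - L)
        & E1 *m F1 = q ^- 2 *: (F1 *m E1) + nu *: (K *m K - 1%:M)]].

(** The recursion without its last term, evaluated at [z]; the coefficients of S_+ and S_- are
    absorbed into [b]. The factors [1] give each component the shape expected by [mul_tens3E]. *)
Definition dress_quad (b : borel_pairs) (z : F) (x : quad 'M[F]_d) :
    quad 'M[F]_(n * d) :=
  ((1 *: (bE1 b *t qG x) + 1 *: (bK b *t qW x) + (- s * z) *: (1%:M *t qW x),
    1 *: (bF2 b *t qT x) + 1 *: (bL b *t qV x) + (- s * z) *: (1%:M *t qV x)),
   ((t * z) *: (bF1 b *t qW x) + (- s * z) *: (bK b *t qG x) + 1 *: (1%:M *t qG x),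
    (t * z) *: (bE2 b *t qV x) + (- s * z) *: (bL b *t qT x) + 1 *: (1%:M *t qT x))).

(** Passing to entries replaces noncommuting operators by scalars, so that [field] can compare the
    two sides once products are normally ordered. *)
Lemma mul_tens3E (c1 c2 c3 e1 e2 e3 : F) (U1 U2 U3 X1 X2 X3 : 'M[F]_n)
    (A1 A2 A3 B1 B2 B3 : 'M[F]_d) i j k l :
  ((c1 *: (U1 *t A1) + c2 *: (U2 *t A2) + c3 *: (U3 *t A3)) *m
   (e1 *: (X1 *t B1) + e2 *: (X2 *t B2) + e3 *: (X3 *t B3)))
    (mxtens_index (i, j)) (mxtens_index (k, l)) =
  c1 * e1 * ((U1 *m X1) i k * (A1 *m B1) j l) +
  c1 * e2 * ((U1 *m X2) i k * (A1 *m B2) j l) +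
  c1 * e3 * ((U1 *m X3) i k * (A1 *m B3) j l) +
  c2 * e1 * ((U2 *m X1) i k * (A2 *m B1) j l) +
  c2 * e2 * ((U2 *m X2) i k * (A2 *m B2) j l) +
  c2 * e3 * ((U2 *m X3) i k * (A2 *m B3) j l) +
  c3 * e1 * ((U3 *m X1) i k * (A3 *m B1) j l) +
  c3 * e2 * ((U3 *m X2) i k * (A3 *m B2) j l) +
  c3 * e3 * ((U3 *m X3) i k * (A3 *m B3) j l).
Proof.
rewrite !mulmxDl !mulmxDr -!(scalemxAl, scalemxAr) !tensmx_mul !scalerA.
have E (a b : 'M[F]_(n * d)) x y : (a + b) x y = a x y + b x y by rewrite mxE.
have S c (a : 'M[F]_(n * d)) x y : (c *: a) x y = c * a x y by rewrite mxE.
by rewrite !E !S !tensmxE !addrA.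
Qed.

Lemma tens_matrixP (A B : 'M[F]_(n * d)) :
  (forall i j k l, A (mxtens_index (i, j)) (mxtens_index (k, l)) =
     B (mxtens_index (i, j)) (mxtens_index (k, l))) -> A = B.
Proof.
move=> h; apply/matrixP=> i j; rewrite -(mxtens_unindexK i) -(mxtens_unindexK j).
by case: (mxtens_unindex i) => a c; case: (mxtens_unindex j) => e g; exact: h.
Qed.

(* Normal ordering: with primes for y, every product is reduced to WW', VV', GG',
   TT', G'W, GW', T'W, TW', G'V, GV', T'V, TV', WV', V'W, VW' and TG', and the
   only denominator that depends on z and w is z - w. *)
Lemma exchange_entries (z w : F) (x y : quad 'M[F]_d) j l :
  q != 0 -> t != 0 -> q - q^-1 != 0 -> z != w -> exchange z w x y ->
  let m A B := (A *m B) j l in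
  [/\ [/\ m (qW y) (qW x) = m (qW x) (qW y), m (qV y) (qV x) = m (qV x) (qV y),
          m (qG y) (qG x) = m (qG x) (qG y) & m (qT y) (qT x) = m (qT x) (qT y)],
      [/\ m (qW x) (qG y) = ((z - q ^- 2 * w) * m (qG y) (qW x)
            - w * (1 - q ^- 2) * m (qG x) (qW y)) / (z - w),
          m (qW y) (qG x) = ((w - q ^- 2 * z) * m (qG x) (qW y)
            - z * (1 - q ^- 2) * m (qG y) (qW x)) / (w - z),
          m (qW x) (qT y) = ((z - q ^+ 2 * w) * m (qT y) (qW x)
            - w * (1 - q ^+ 2) * m (qT x) (qW y)) / (z - w)
        & m (qW y) (qT x) = ((w - q ^+ 2 * z) * m (qT x) (qW y)
            - z * (1 - q ^+ 2) * m (qT y) (qW x)) / (w - z)],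
      [/\ m (qV x) (qT y) = ((z - q ^- 2 * w) * m (qT y) (qV x)
            - w * (1 - q ^- 2) * m (qT x) (qV y)) / (z - w),
          m (qV y) (qT x) = ((w - q ^- 2 * z) * m (qT x) (qV y)
            - z * (1 - q ^- 2) * m (qT y) (qV x)) / (w - z),
          m (qV x) (qG y) = ((z - q ^+ 2 * w) * m (qG y) (qV x)
            - w * (1 - q ^+ 2) * m (qG x) (qV y)) / (z - w)
        & m (qV y) (qG x) = ((w - q ^+ 2 * z) * m (qG x) (qV y)
            - z * (1 - q ^+ 2) * m (qG y) (qV x)) / (w - z)]
    & [/\ m (qG y) (qT x) = m (qT x) (qG y)
            + q * t * (q - q^-1) * z * w / (z - w)
              * (m (qV x) (qW y) - m (qV y) (qW x)),
          m (qG x) (qT y) = m (qG y) (qT x)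
            - q * t * (z - w) / (q - q^-1) * (m (qW x) (qV y) - m (qV y) (qW x)),
          m (qT y) (qG x) = m (qG x) (qT y)
            + q * t * (q - q^-1) * z * w / (z - w)
              * (m (qV y) (qW x) - m (qV x) (qW y))
        & m (qW y) (qV x) = m (qW x) (qV y) - m (qV y) (qW x) + m (qV x) (qW y)]].
Proof.
move=> q0 t0 dq zw; case: x => [[W V] [G T]]; case: y => [[W' V'] [G' T']].
case=> -[/= a1 a2 a3 [a4 a5 a6]] [/= b1 b2 b3 [b4 b5 b6]].
case=> [/= c1 c2 c3 [c4 c5 c6]] [/= d1 d2 d3 [d4 d5 d6]].
have zw0 : z - w != 0 by rewrite subr_eq0.
have wz0 : w - z != 0 by rewrite subr_eq0 eq_sym.
have D (a b : 'M[F]_d) : (a + b) j l = a j l + b j l by rewrite mxE.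
have N (a : 'M[F]_d) : (- a) j l = - a j l by rewrite mxE.
have S c (a : 'M[F]_d) : (c *: a) j l = c * a j l by rewrite mxE.
have e A B : A = B :> 'M[F]_d -> A j l = B j l by move=> ->.
move/e: a3; move/e: b3; move/e: a4; move/e: b4; move/e: c3; move/e: d3.
move/e: c4; move/e: d4; move/e: a5; move/e: b5; move/e: a6; move/e: b6.
rewrite !(D, N, S) => b6 a6 b5 a5 d4 c4 d3 c3 b4 a4 b3 a3.
have qt0 : q * t * (z - w) != 0 by rewrite !mulf_neq0.
have div c a b : c != 0 -> c * a = b -> a = b / c :> F.
  by move=> c0 h; apply: (canRL (mulfK c0)); rewrite mulrC.
have sub a b c : a - b = c -> b = a - c :> F by move=> <-; rewrite subKr.
split; split; rewrite ?a1 ?a2 ?c1 ?c2 //; try exact: div.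
- by rewrite (sub _ _ _ (div _ _ _ zw0 a6)); field; rewrite q0 zw0.
- rewrite (sub _ _ _ (div _ _ _ dq (esym a5))); field.
  by rewrite q0 sqrB1_neq0.
- by rewrite (sub _ _ _ (div _ _ _ wz0 b6)); field; rewrite ?q0 ?zw0 ?wz0.
(* The fifth relations at (z, w) and at (w, z) have opposite right-hand sides and opposite factors
   on the left, so the two commutators of W and V agree. *)
apply: (mulfI qt0).
have -> : q * t * (z - w) * (W' *m V) j l =
  q * t * (z - w) * (V *m W') j l
  - q * t * (w - z) * ((W' *m V) j l - (V *m W') j l) by ring.
have -> : q * t * (z - w) * ((W *m V') j l - (V' *m W) j l + (V *m W') j l) =
  q * t * (z - w) * (V *m W') j l
  + q * t * (z - w) * ((W *m V') j l - (V' *m W) j l) by ring.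
by rewrite a5 b5; ring.
Qed.

End Dressing.
End Exchange.

(** Products are put in normal order in both tensor factors, by [half_borel] in the first and by
    [exchange_entries] in the second. What remains is an identity of rational functions in the
    surviving entries. *)
Lemma dress_half_exchange (F : fieldType) (q t : F) n d s (b : borel_pairs F n)
    z w (x y : quad 'M[F]_d) :
  q != 0 -> t != 0 -> q - q^-1 != 0 -> z != w ->
  half_borel q t s b -> exchange q t z w x y ->
  half_exchange q t z w (dress_quad t s b z x) (dress_quad t s b w y).
Proof.
move=> q0 t0 dq zw hb xy.
case: b hb => E1 E2 F1 F2 K L [] [KL LK KE1 KF1] [KE2 E2K LE1 E1L] [KF2 F2K LF1 F1L]
  [E1E2 F1E2 E1F2 E2F1 E1F1].
have D p r (a c : 'M[F]_(p,r)) i k : (a + c) i k = a i k + c i k by rewrite mxE.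
have N p r (a : 'M[F]_(p,r)) i k : (- a) i k = - a i k by rewrite mxE.
have S p r c (a : 'M[F]_(p,r)) i k : (c *: a) i k = c * a i k by rewrite mxE.
have zw0 : z - w != 0 by rewrite subr_eq0.
have wz0 : w - z != 0 by rewrite subr_eq0 eq_sym.
have qq := sqrB1_neq0 q0 dq.
split; last split; apply: tens_matrixP => i j k l;
  rewrite ?(D, N, S) !mul_tens3E /=;
  have [[eW eV eG eT] [h1 h2 h3 h4] [h5 h6 h7 h8] [h9 h10 h11 h12]] :=
    exchange_entries j l q0 t0 dq zw xy;
  (* The order matters: [h11] produces GT', which [h10] turns into G'T, which [h9] turns into
     TG'. *)
  rewrite !(mulmx1, mul1mx) ?(KL, LK, KE1, KF1, KE2, E2K, LE1, E1L, KF2, F2K,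
      LF1, F1L, E1E2, F1E2, E1F2, E2F1, E1F1) ?(D, N, S) ?eW ?eV ?eG ?eT
    ?h12 ?h11 ?h10 ?h9 ?h8 ?h7 ?h6 ?h5 ?h4 ?h3 ?h2 ?h1 ?h10 ?h9 /nu.
all: by field; rewrite ?q0 ?t0 ?zw0 ?wz0 ?qq.
Qed.

(** Swapping the quadruple and the Borel elements together commutes with dressing, so all four
    halves reduce to [dress_half_exchange]. *)
Lemma dress_exchange (F : fieldType) (q t : F) n d s (b : borel_pairs F n) z w
    (x y : quad 'M[F]_d) :
  q != 0 -> t != 0 -> q - q^-1 != 0 -> z != w ->
  half_borel q t s b -> half_borel q t s (borel_swap b) ->
  exchange q t z w x y ->
  exchange q t z w (dress_quad t s b z x) (dress_quad t s b w y).
Proof.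
move=> q0 t0 dq zw hb hb' xy; have wz : w != z by rewrite eq_sym.
have dress_swap u (a : quad 'M[F]_d) : quad_swap (dress_quad t s b u a) =
    dress_quad t s (borel_swap b) u (quad_swap a) by [].
split; rewrite ?dress_swap; apply: dress_half_exchange => //.
- exact: exchange_sym.
- exact: exchange_swap.
- exact/exchange_sym/exchange_swap.
Qed.

(** * From values at points to coefficients of series *)

Definition delay (V : zmodType) (f : nat -> V) (k : nat) : V :=
  if k is i.+1 then f i else 0.

Section Coefficients.
Variables (F : fieldType) (e : nat -> F) (e_inj : injective e).

(** Among [(size p).+1] values of the injective sequence [e] at most one is [z], so a nonzero [p]
    would have at least [size p] distinct roots. *)
Lemma poly_eq0_almost (p : {poly F}) z :
  (forall w, w != z -> p.[w] = 0) -> p = 0.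
Proof.
move=> pz; apply/eqP; apply: contraT => p0.
pose s := [seq e i | i <- iota 0 (size p).+1 & e i != z].
have us : uniq s by rewrite map_inj_uniq // filter_uniq // iota_uniq.
have rs : all (root p) s.
  by apply/allP=> _ /mapP[i + ->]; rewrite mem_filter => /andP[/pz h _]; apply/eqP.
have := max_poly_roots p0 rs us; rewrite ltnNge size_map size_filter => /negP[].
have := count_predC (fun i => e i == z) (iota 0 (size p).+1).
rewrite size_iota -(count_map e (pred1 z)) count_uniq_mem ?map_inj_uniq ?iota_uniq //.
by move=> E; rewrite -ltnS -[leqLHS]E; apply: leq_add (leq_b1 _) (leqnn _).
Qed.

(** For fixed [z] the sum is a polynomial in [w] that vanishes off [w = z], hence is zero; each of
    its coefficients is then a polynomial in [z] that vanishes everywhere. *)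
Lemma bivariate_eq0 (a : nat -> nat -> F) D :
  (forall z w, z != w -> \sum_(k < D) \sum_(l < D) z ^+ k * w ^+ l * a k l = 0) ->
  forall k l, (k < D)%N -> (l < D)%N -> a k l = 0.
Proof.
move=> h k l kD lD.
have hz z : \sum_(i < D) z ^+ i * a i l = 0.
  pose p := \poly_(j < D) \sum_(i < D) z ^+ i * a i j.
  have /(congr1 (fun r : {poly F} => r`_l)) : p = 0.
    apply: (poly_eq0_almost (z := z)) => w wz; rewrite -[RHS](h z w) 1?eq_sym //.
    rewrite horner_poly exchange_big /=; apply: eq_bigr => j _.
    by rewrite mulr_suml; apply: eq_bigr => i _; rewrite mulrAC.
  by rewrite coef_poly lD coef0.
have /(congr1 (fun r : {poly F} => r`_k)) : \poly_(i < D) a i l = 0.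
  apply: (poly_eq0_almost (z := 0)) => z _; rewrite horner_poly -[RHS](hz z).
  by apply: eq_bigr => i _; rewrite mulrC.
by rewrite coef_poly kD coef0.
Qed.

Definition bilinear_form (P V : lmodType F) (B : P -> P -> V) : Prop :=
  (forall y, linear (B^~ y)) /\ (forall x, linear (B x)).

Section Bilinear.
Variables (P : lmodType F) (m n : nat) (B : P -> P -> 'M[F]_(m, n)).
Hypothesis bB : bilinear_form B.

Let Bl y : {linear P -> 'M[F]_(m, n)} := HB.pack (B^~ y)
  (GRing.isLinear.Build F P 'M[F]_(m, n) *:%R (B^~ y) (bB.1 y)).
Let Br x : {linear P -> 'M[F]_(m, n)} := HB.pack (B x)
  (GRing.isLinear.Build F P 'M[F]_(m, n) *:%R (B x) (bB.2 x)).

Lemma bilinear_suml I (r : seq I) (a : I -> F) (f : I -> P) y :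
  B (\sum_(i <- r) a i *: f i) y = \sum_(i <- r) a i *: B (f i) y.
Proof.
rewrite -[LHS]/(Bl y _) raddf_sum; apply: eq_bigr => i _.
exact: linearZZ.
Qed.

Lemma bilinear_sumr I (r : seq I) (a : I -> F) (f : I -> P) x :
  B x (\sum_(i <- r) a i *: f i) = \sum_(i <- r) a i *: B x (f i).
Proof.
rewrite -[LHS]/(Br x _) raddf_sum; apply: eq_bigr => i _.
exact: linearZZ.
Qed.

(** By bilinearity the value at two polynomials is the bivariate polynomial with coefficients
    [B (f k) (f l)]. *)
Lemma bilinear_coef_eq0 D (f : nat -> P) :
  (forall z w, z != w ->
    B (\sum_(k < D) z ^+ k *: f k) (\sum_(k < D) w ^+ k *: f k) = 0) ->
  (forall k, (D <= k)%N -> f k = 0) -> forall k l, B (f k) (f l) = 0.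
Proof.
move=> h f0 k l.
have B0l y : B 0 y = 0 by rewrite -[LHS]/(Bl y 0) raddf0.
have B0r x : B x 0 = 0 by rewrite -[LHS]/(Br x 0) raddf0.
have [kD|/f0->//] := ltnP k D; have [lD|/f0->//] := ltnP l D.
apply/matrixP=> i j; rewrite [RHS]mxE.
apply: (bivariate_eq0 (a := fun k l => B (f k) (f l) i j) _ kD lD) => z w /h.
move=> /matrixP/(_ i j); rewrite [RHS]mxE => E; rewrite -[RHS]E.
rewrite bilinear_suml summxE; apply: eq_bigr => k' _.
rewrite bilinear_sumr mxE summxE mulr_sumr; apply: eq_bigr => l' _.
by rewrite mxE mulrA.
Qed.

(** This is division by [1 - c z] in one argument and by [1 - c w] in the other: the recursion is
    unrolled by induction on the left index, then on the right one. *)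
Lemma bilinear_delay_eq0 c (f : nat -> P) :
  (forall k l, B (f k - c *: delay f k) (f l - c *: delay f l) = 0) ->
  forall k l, B (f k) (f l) = 0.
Proof.
move=> h.
have Bll y u v : B (u - c *: v) y = B u y - c *: B v y.
  by rewrite -[LHS]/(Bl y _) linearB linearZ.
have Brr y u v : B y (u - c *: v) = B y u - c *: B y v.
  by rewrite -[LHS]/(Br y _) linearB linearZ.
have B0l y : B 0 y = 0 by rewrite -[LHS]/(Bl y 0) raddf0.
have B0r x : B x 0 = 0 by rewrite -[LHS]/(Br x 0) raddf0.
have hk k l : B (f k) (f l - c *: delay f l) = 0.
  elim: k => [|k IH]; first by have := h 0%N l; rewrite /= scaler0 subr0.
  by have := h k.+1 l; rewrite Bll /= IH scaler0 subr0.
move=> k; elim=> [|l IH]; first by have := hk k 0%N; rewrite /= scaler0 subr0.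
by have := hk k l.+1; rewrite Brr /= IH scaler0 subr0.
Qed.

End Bilinear.
End Coefficients.

Section BilinearForms.
Variables (F : fieldType) (P : lmodType F) (d : nat).
Implicit Types (B : P -> P -> 'M[F]_d) (f g : P -> 'M[F]_d).

Lemma bilinear_mul f g :
  linear f -> linear g -> bilinear_form (fun x y => f x *m g y).
Proof.
move=> lf lg; split=> [y|x] a u v; rewrite ?lf ?lg.
  by rewrite mulmxDl -scalemxAl.
by rewrite mulmxDr -scalemxAr.
Qed.

Lemma bilinear_mul_op f g :
  linear f -> linear g -> bilinear_form (fun x y => g y *m f x).
Proof.
move=> lf lg; split=> [y|x] a u v; rewrite ?lf ?lg.
  by rewrite mulmxDr -scalemxAr.
by rewrite mulmxDl -scalemxAl.
Qed.

Lemma bilinear_sub B B' : bilinear_form B -> bilinear_form B' ->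
  bilinear_form (fun x y => B x y - B' x y).
Proof.
move=> [l r] [l' r']; split=> [y|x] a u v; rewrite ?l ?l' ?r ?r'.
  by rewrite scalerBr opprD addrACA.
by rewrite scalerBr opprD addrACA.
Qed.

Lemma bilinear_scale c B : bilinear_form B -> bilinear_form (fun x y => c *: B x y).
Proof.
move=> [l r]; split=> [y|x] a u v; rewrite ?l ?r scalerDr !scalerA.
  by rewrite mulrC.
by rewrite mulrC.
Qed.

End BilinearForms.

(** * Exchange relations on coefficients *)

Section ExchangeForms.
Variables (F : fieldType) (q t : F) (d : nat).
Local Notation M := 'M[F]_d.

(* Consequences of exchange z w x y, with X = (x, z *: x) and Y = (y, w *: y). *)
Definition exchange_form (i : nat) (X Y : quad M * quad M) : M :=
  let x := X.1 in let px := X.2 in let y := Y.1 in let py := Y.2 in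
  match i with
  | 0 => qW x *m qW y - qW y *m qW x
  | 1 => qG x *m qG y - qG y *m qG x
  | 2 => qW px *m qG y - qW x *m qG py - qG y *m qW px
         - (- q ^- 2) *: (qG py *m qW x) - (- (1 - q ^- 2)) *: (qG x *m qW py)
  | 3 => qW px *m qT y - qW x *m qT py - qT y *m qW px
         - (- q ^+ 2) *: (qT py *m qW x) - (- (1 - q ^+ 2)) *: (qT x *m qW py)
  | 4 => (q * t) *: (qW px *m qV y - qV y *m qW px - (qW x *m qV py
                     - qV py *m qW x))
         - (q - q^-1) *: (qG y *m qT x - qG x *m qT y)
  | 5 => qW x *m qV y - qV y *m qW x - (qW y *m qV x - qV x *m qW y)
  | 6 => qW px *m qG y - qG y *m qW px - (qW py *m qG x - qG x *m qW py)
  | 7 => qW px *m qT y - qT y *m qW px - (qW py *m qT x - qT x *m qW py)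
  | _ => qT x *m qG y - qG y *m qT x - (qT y *m qG x - qG x *m qT y)
  end.

Lemma exchange_form_bilinear i : bilinear_form (exchange_form i).
Proof.
case: i => [|[|[|[|[|[|[|[|i]]]]]]]]; cbv beta iota zeta delta [exchange_form];
  repeat first [apply: bilinear_sub | apply: bilinear_scale | apply: bilinear_mul
   | apply: bilinear_mul_op]; by [].
Qed.

Definition quad_swap2 (X : quad M * quad M) := (quad_swap X.1, quad_swap X.2).

Lemma exchange_form_swap_bilinear i :
  bilinear_form (fun X Y => exchange_form i (quad_swap2 X) (quad_swap2 Y)).
Proof.
have [l r] := exchange_form_bilinear i.
split=> [Y|X] a u v; [have h := l (quad_swap2 Y) a (quad_swap2 u) (quad_swap2 v)
  | have h := r (quad_swap2 X) a (quad_swap2 u) (quad_swap2 v)]; exact: h.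
Qed.

Lemma exchange_form_eq0 z w (x y : quad M) i :
  q != 0 -> t != 0 -> q - q^-1 != 0 -> z != w ->
  exchange q t z w x y -> exchange_form i (x, z *: x) (y, w *: y) = 0.
Proof.
move=> q0 t0 dq zw xy.
have D (a c : M) j k : (a + c) j k = a j k + c j k by rewrite mxE.
have N (a : M) j k : (- a) j k = - a j k by rewrite mxE.
have S c (a : M) j k : (c *: a) j k = c * a j k by rewrite mxE.
have Z j k : (0 : M) j k = 0 by rewrite mxE.
have zw0 : z - w != 0 by rewrite subr_eq0.
have wz0 : w - z != 0 by rewrite subr_eq0 eq_sym.
have qq := sqrB1_neq0 q0 dq.
apply/matrixP=> j l; have [[eW eV eG eT] [h1 h2 h3 h4] [h5 h6 h7 h8]
  [h9 h10 h11 h12]] := exchange_entries j l q0 t0 dq zw xy.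
case: i => [|[|[|[|[|[|[|[|i]]]]]]]] /=; rewrite -?scalemxAl -?scalemxAr !(D, N, S, Z)
  ?eW ?eV ?eG ?eT ?h12 ?h11 ?h10 ?h9 ?h8 ?h7 ?h6 ?h5 ?h4 ?h3 ?h2 ?h1 ?h10 ?h9;
  by field; rewrite ?q0 ?t0 ?zw0 ?wz0 ?qq.
Qed.

(* f is, up to division by finitely many factors 1 - c z, a polynomial in z that
   satisfies the exchange relations. *)
Inductive rational_exchange : (nat -> quad M) -> Prop :=
| exchange_poly D (f : nat -> quad M) : (forall k, (D <= k)%N -> f k = 0) ->
    (forall z w, z != w ->
      exchange q t z w (\sum_(k < D) z ^+ k *: f k) (\sum_(k < D) w ^+ k *: f k)) ->
    rational_exchange f
| exchange_div c (f h : nat -> quad M) : (forall k, h k = f k - c *: delay f k) ->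
    rational_exchange h -> rational_exchange f.

Lemma sum_delay (P : lmodType F) (f : nat -> P) z D :
  \sum_(k < D.+1) z ^+ k *: delay f k = z *: \sum_(k < D) z ^+ k *: f k.
Proof.
rewrite big_ord_recl scaler0 add0r scaler_sumr.
by apply: eq_bigr => k _; rewrite scalerA -exprS.
Qed.

(** The coefficients of the pair [(x, z *: x)]. Storing the multiple by [z] as a second component
    makes relations that involve [z] and [w] bilinear forms free of both. *)
Definition with_delay (f : nat -> quad M) k : quad M * quad M := (f k, delay f k).

Lemma rational_exchange_coef (e : nat -> F) f : injective e ->
  q != 0 -> t != 0 -> q - q^-1 != 0 -> rational_exchange f ->
  forall i k l, exchange_form i (with_delay f k) (with_delay f l) = 0 /\
    exchange_form i (quad_swap2 (with_delay f k)) (quad_swap2 (with_delay f l)) = 0.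
Proof.
move=> e_inj q0 t0 dq; elim=> {f} [D f f0 xf|c f h hE _ IH] i.
  (* The bound grows by one because the delayed component has degree one higher. *)
  have wf0 k : (D.+1 <= k)%N -> with_delay f k = 0.
    by case: k => // k Dk; rewrite /with_delay /= (f0 k) // (f0 k.+1) // leqW.
  have wE z : \sum_(k < D.+1) z ^+ k *: with_delay f k =
      (\sum_(k < D) z ^+ k *: f k, z *: \sum_(k < D) z ^+ k *: f k).
    rewrite -sum_delay [LHS]surjective_pairing !raddf_sum /=.
    by rewrite [in LHS]big_ord_recr /= f0 // scaler0 addr0.
  move=> k l; split.
    apply: (bilinear_coef_eq0 e_inj (exchange_form_bilinear i) _ wf0) => z w zw.
    by rewrite !wE; exact: (exchange_form_eq0 i q0 t0 dq zw (xf z w zw)).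
  apply: (bilinear_coef_eq0 e_inj (exchange_form_swap_bilinear i) _ wf0) => z w zw.
  rewrite wE wE.
  exact: (exchange_form_eq0 i q0 t0 dq zw (exchange_swap (xf z w zw))).
have wE k : with_delay f k - c *: delay (with_delay f) k = with_delay h k.
  by rewrite /with_delay hE; case: k => [|k] /=; rewrite ?hE //= !scaler0 !subr0.
move=> k l; split.
  by apply: (bilinear_delay_eq0 (exchange_form_bilinear i) (c := c)) => {}k {}l;
  rewrite !wE; case: (IH i k l).
by apply: (bilinear_delay_eq0 (exchange_form_swap_bilinear i) (c := c)) => {}k {}l;
  rewrite !wE; case: (IH i k l).
Qed.

End ExchangeForms.

(** * Dressing of coefficient sequences *)

Section DressSequence.
Variables (F : fieldType) (q t : F) (n d : nat) (s : F) (b : borel_pairs F n).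

Definition dress_coef0 (x : quad 'M[F]_d) : quad 'M[F]_(n * d) :=
  ((bE1 b *t qG x + bK b *t qW x, bF2 b *t qT x + bL b *t qV x),
   (1%:M *t qG x, 1%:M *t qT x)).

Definition dress_coef1 (x : quad 'M[F]_d) : quad 'M[F]_(n * d) :=
  ((- s *: (1%:M *t qW x), - s *: (1%:M *t qV x)),
   (t *: (bF1 b *t qW x) - s *: (bK b *t qG x),
    t *: (bE2 b *t qV x) - s *: (bL b *t qT x))).

Definition dress_seq (f : nat -> quad 'M[F]_d) k :=
  dress_coef0 (f k) + dress_coef1 (delay f k).

Lemma dress_quadE z x : dress_quad t s b z x = dress_coef0 x + z *: dress_coef1 x.
Proof.
congr ((_, _), (_, _)); apply/matrixP=> i j; rewrite !mxE; ring.
Qed.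

Lemma dress_coef0_linear : linear dress_coef0.
Proof.
move=> a x y; congr ((_, _), (_, _)); apply/matrixP=> i j; rewrite !mxE; ring.
Qed.

Lemma dress_coef1_linear : linear dress_coef1.
Proof.
move=> a x y; congr ((_, _), (_, _)); apply/matrixP=> i j; rewrite !mxE; ring.
Qed.

HB.instance Definition _ := GRing.isLinear.Build F (quad 'M[F]_d)
  (quad 'M[F]_(n * d)) *:%R dress_coef0 dress_coef0_linear.
HB.instance Definition _ := GRing.isLinear.Build F (quad 'M[F]_d)
  (quad 'M[F]_(n * d)) *:%R dress_coef1 dress_coef1_linear.

(** Dressing is linear over scalar series, so it commutes with the factors [1 - c z]; on polynomials
    it is [dress_quad] at each point and raises the degree bound by one. *)
Lemma dress_seq_rational f :
  q != 0 -> t != 0 -> q - q^-1 != 0 ->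
  half_borel q t s b -> half_borel q t s (borel_swap b) ->
  rational_exchange q t f -> rational_exchange q t (dress_seq f).
Proof.
move=> q0 t0 dq hb hb'; elim=> {f} [D f f0 xf|c f h hE _ IH].
  apply: (exchange_poly (D := D.+1)) => [k Dk|z w zw].
    case: k Dk => // k Dk.
    by rewrite /dress_seq /= (f0 k) // (f0 k.+1) ?leqW // !raddf0 addr0.
  have ev u : \sum_(k < D.+1) u ^+ k *: dress_seq f k =
      dress_quad t s b u (\sum_(k < D) u ^+ k *: f k).
    rewrite dress_quadE -linearZZ -sum_delay.
    have -> : \sum_(k < D) u ^+ k *: f k = \sum_(k < D.+1) u ^+ k *: f k.
      by rewrite big_ord_recr /= f0 // scaler0 addr0.
    rewrite !linear_sum -big_split; apply: eq_bigr => k _.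
    by rewrite /dress_seq [LHS]scalerDr !linearZZ.
  by rewrite !ev; apply: dress_exchange => //; exact: xf.
apply: (exchange_div (c := c)) IH => k.
rewrite /dress_seq hE; case: k => [|k] /=.
  by rewrite !scaler0 !subr0.
have e0 x y : dress_coef0 (x - c *: y) = dress_coef0 x - c *: dress_coef0 y.
  by rewrite raddfB; congr (_ - _); apply: linearZZ.
have e1 x y : dress_coef1 (x - c *: y) = dress_coef1 x - c *: dress_coef1 y.
  by rewrite raddfB; congr (_ - _); apply: linearZZ.
rewrite hE e0 e1 addrACA -opprD; congr (_ - _).
exact/esym/scalerDr.
Qed.

End DressSequence.

(** * Relations of U_q(sl_2) in the spin representations *)

Section QuantumRelations.
Variables (F : fieldType) (q t s : F) (n : nat) (X Y K L : 'M[F]_n).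
Hypotheses (q0 : q != 0) (KL : K *m L = 1%:M) (LK : L *m K = 1%:M)
  (KX : K *m X = q ^+ 2 *: (X *m K)) (KY : K *m Y = q ^- 2 *: (Y *m K))
  (XY : X *m Y = q ^+ 2 *: (Y *m X) + (q ^+ 2 * nu q t s) *: (1%:M - L *m L)).

(** In the application [X] and [Y] are multiples of S_+ q^{-s_3} and S_- q^{-s_3}, and right
    multiplication by [K], that is q^{2 s_3}, gives the other two elements. *)
Definition quantum_borel := BorelPairs (X *m K) X (Y *m K) Y K L.

Lemma quantum_half_borel :
  half_borel q t s quantum_borel /\ half_borel q t s (borel_swap quantum_borel).
Proof.
have q2 : q ^+ 2 != 0 by rewrite expf_neq0.
have LX : L *m X = q ^- 2 *: (X *m L).
  apply: (scalerI q2); rewrite scalerA mulfV // scale1r.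
  by rewrite -[X in X *m L]mul1mx -LK -!mulmxA (mulmxA K) KX
    -scalemxAl -scalemxAr -!mulmxA KL mulmx1.
have LY : L *m Y = q ^+ 2 *: (Y *m L).
  rewrite -[Y in Y *m L]mul1mx -LK -!mulmxA (mulmxA K) KY -scalemxAl -scalemxAr.
  by rewrite -!mulmxA KL mulmx1 scalerA mulfV // scale1r.
have KXm A : K *m (X *m A) = q ^+ 2 *: (X *m (K *m A)).
  by rewrite mulmxA KX -scalemxAl mulmxA.
have KYm A : K *m (Y *m A) = q ^- 2 *: (Y *m (K *m A)).
  by rewrite mulmxA KY -scalemxAl mulmxA.
have LXm A : L *m (X *m A) = q ^- 2 *: (X *m (L *m A)).
  by rewrite mulmxA LX -scalemxAl mulmxA.
have LYm A : L *m (Y *m A) = q ^+ 2 *: (Y *m (L *m A)).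
  by rewrite mulmxA LY -scalemxAl mulmxA.
have KLm A : K *m (L *m A) = A by rewrite mulmxA KL mul1mx.
have LKm A : L *m (K *m A) = A by rewrite mulmxA LK mul1mx.
have XYm A : X *m (Y *m A) =
    q ^+ 2 *: (Y *m (X *m A)) + (q ^+ 2 * nu q t s) *: (A - L *m (L *m A)).
  by rewrite mulmxA XY mulmxDl -!scalemxAl mulmxBl mul1mx !mulmxA.
have D (a c : 'M[F]_n) i k : (a + c) i k = a i k + c i k by rewrite mxE.
have N (a : 'M[F]_n) i k : (- a) i k = - a i k by rewrite mxE.
have S c (a : 'M[F]_n) i k : (c *: a) i k = c * a i k by rewrite mxE.
split; (split; split); cbv [bE1 bE2 bF1 bF2 bK bL];
 (* [K] and [L] move to the right and [Y] to the left of [X]; the rules ending in [m] act inside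
    longer right-associated words. *)
 rewrite -?mulmxA ?(KX, KY, LX, LY, KXm, KYm, LXm, LYm, KL, LK, KLm, LKm, XYm, XY, mulmx1)
   -?scalemxAr -?mulmxA ?(KL, LK, KLm, LKm, XYm, XY, mulmx1) //;
 apply/matrixP=> i j; rewrite !(D, N, S); by field.
Qed.

End QuantumRelations.

(** The hypothesis [XY] for the spin representation, entry by entry: [e] stands for an entry of S_-
    S_+ q^{-2 s_3} and [c] for one of 1 - q^{-4 s_3}. *)
Lemma spin_coefficient (F : fieldType) (q t a b c e : F) :
  q != 0 -> t != 0 -> q - q^-1 != 0 ->
  a * (b * (q * (e + (q - q^-1)^-1 * c))) =
  q ^+ 2 * (b * (a * (q^-1 * e))) +
  q ^+ 2 * (a * b * t / (q - q^-1) ^+ 2 * (q - q^-1) / (q * t)) * c.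
Proof.
by move=> q0 t0 dq; field; rewrite q0 t0 sqrB1_neq0.
Qed.

Section SpinRelations.
Variables (K : closedFieldType) (n : nat).
Local Notation F := (scalars K).
Local Notation q := (q K).
Local Notation qh := (qh K).
Local Notation Sp := (Splus K n).
Local Notation Sm := (Sminus K n).
Local Notation qs := (qs3 K n).

Lemma q_neq0 : q != 0.
Proof. by rewrite expf_neq0 ?qh_neq0. Qed.

Lemma qBV_neq0 : q - q^-1 != 0.
Proof. exact: (qXB_neq0 K (m := 1)). Qed.

Lemma qDV_neq0 : q + q^-1 != 0.
Proof.
apply: contraNneq (qXB_neq0 K (m := 2) isT) => h.
by rewrite -exprVn subr_sqr mulrC h mul0r.
Qed.

(** These powers serve as the infinite supply of evaluation points. *)
Lemma qhX_inj : injective (fun i : nat => qh ^+ i).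
Proof.
have le i j : (i < j)%N -> qh ^+ i != qh ^+ j.
  move=> ij; rewrite -(subnKC (ltnW ij)) exprD -[X in X == _]mulr1.
  rewrite (inj_eq (mulfI (expf_neq0 i (qh_neq0 K)))) eq_sym.
  by rewrite qhX_neq1 // subn_gt0.
move=> i j /eqP ij; case: (ltngtP i j) => // /le; rewrite ?ij //.
by rewrite eq_sym ij.
Qed.

Lemma qs3D a c : qs a *m qs c = qs (a + c).
Proof.
rewrite mulmx_diag; congr diag_mx; apply/rowP=> i; rewrite !mxE.
by rewrite -expfzDr ?qh_neq0 // mulrDl.
Qed.

Lemma qs30 : qs 0 = 1%:M.
Proof. by apply/matrixP=> i j; rewrite !mxE mul0r expr0z. Qed.

Lemma qs3_Splus m : qs m *m Sp = qh ^ (2 * m) *: (Sp *m qs m).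
Proof.
apply/matrixP=> i j; rewrite mul_diag_mx mul_mx_diag !mxE.
case: eqP => [->|_]; last by rewrite mulr0 mul0r mulr0.
rewrite [RHS]mulrCA -expfzDr ?qh_neq0 // mulrC; congr (_ * _ ^ _).
by lia.
Qed.

Lemma qs3_Sminus m : qs m *m Sm = qh ^ (- (2 * m)) *: (Sm *m qs m).
Proof.
apply/matrixP=> i j; rewrite mul_diag_mx mul_mx_diag !mxE.
case: eqP => [->|_]; last by rewrite mulr0 mul0r mulr0.
rewrite [RHS]mulrCA -expfzDr ?qh_neq0 // mulrC; congr (_ * _ ^ _).
by lia.
Qed.

Section SpinBorel.
Variables (a b t : F).
Hypothesis t0 : t != 0.

Let X := a *: (Sp *m qs (-1)).
Let Y := b *: (Sm *m qs (-1)).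
Let s := a * b * t / (q - q^-1) ^+ 2.

Lemma spin_half_borel :
  let B := quantum_borel X Y (qs 2) (qs (-2)) in
  half_borel q t s B /\ half_borel q t s (borel_swap B).
Proof.
have q2E : qh ^ (2 * 2) = q ^+ 2 by rewrite /q -exprM.
have q2E' : qh ^ (- (2 * 2)) = q ^- 2 by rewrite /q -exprM -exprnN.
apply: quantum_half_borel.
- exact: q_neq0.
- by rewrite qs3D subrr qs30.
- by rewrite qs3D addNr qs30.
- rewrite /X -!(scalemxAl, scalemxAr) mulmxA qs3_Splus q2E -scalemxAl -!mulmxA !qs3D.
  by rewrite !scalerA mulrC.
- rewrite /Y -!(scalemxAl, scalemxAr) mulmxA qs3_Sminus q2E' -scalemxAl -!mulmxA !qs3D.
  by rewrite !scalerA mulrC.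
have PM : (Sp *m qs (-1)) *m (Sm *m qs (-1)) = q *: (Sp *m Sm *m qs (-2)).
  rewrite -mulmxA (mulmxA (qs _)) qs3_Sminus -scalemxAl -scalemxAr.
  by rewrite -(mulmxA Sm) qs3D mulmxA.
have MP : (Sm *m qs (-1)) *m (Sp *m qs (-1)) = q^-1 *: (Sm *m Sp *m qs (-2)).
  rewrite -mulmxA (mulmxA (qs _)) qs3_Splus -scalemxAl -scalemxAr.
  by rewrite -(mulmxA Sp) qs3D mulmxA.
have SS : Sp *m Sm *m qs (-2) = Sm *m Sp *m qs (-2)
    + (q - q^-1)^-1 *: (1%:M - qs (-2) *m qs (-2)).
  rewrite -[LHS](subrK (Sm *m Sp *m qs (-2))) addrC.
  congr (_ + _); rewrite -mulmxBl Splus_Sminus -scalemxAl mulmxBl [qs 2 *m _]qs3D subrr.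
  by rewrite qs30.
rewrite /X /Y -!(scalemxAl, scalemxAr) PM MP SS.
apply/matrixP=> i j.
have D (c e : 'M[F]_n.+1) : (c + e) i j = c i j + e i j by rewrite mxE.
have S c (e : 'M[F]_n.+1) : (c *: e) i j = c * e i j by rewrite mxE.
rewrite !(D, S); exact: (spin_coefficient _ _ _ _ q_neq0 t0 qBV_neq0).
Qed.

End SpinBorel.
End SpinRelations.

(** * The recursion as iterated dressing, and its initial data *)

Lemma dress_coefficients (F : fieldType) (kp km u h q : F) :
  kp != 0 -> km != 0 -> h != 0 -> q = h ^+ 2 -> q - q^-1 != 0 -> q + q^-1 != 0 ->
  let a := (q - q^-1) / (km * (q + q^-1) ^+ 2) * u * h in
  let b := (q - q^-1) / (kp * (q + q^-1) ^+ 2) * u * h in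
  let t := kp * km * (q + q^-1) ^+ 2 * (q + q^-1) / q in
  [/\ a * b * t / (q - q^-1) ^+ 2 = u ^+ 2 / (q + q^-1),
      t * b = (q ^+ 2 - q ^- 2) * km * u * h^-1
    & t * a = (q ^+ 2 - q ^- 2) * kp * u * h^-1].
Proof.
move=> kp0 km0 h0 qE dq pq /=.
have q0 : q != 0 by rewrite qE expf_neq0.
have dq' := sqrB1_neq0 q0 dq; have pq' := sqrD1_neq0 q0 pq.
rewrite qE in dq' pq' *.
by split; field; rewrite ?kp0 ?km0 ?h0 ?dq' ?pq'.
Qed.

Lemma scale_tensmx (R : comPzRingType) m n p r c (A : 'M[R]_(m, n)) (B : 'M[R]_(p, r)) :
  (c *: A) *t B = c *: (A *t B).
Proof. by apply/matrixP=> i j; rewrite !mxE mulrA. Qed.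

Lemma tens1_scalar (F : fieldType) n d (c : F) :
  (1%:M : 'M_n) *t (c%:M : 'M_d) = c%:M.
Proof.
apply: tens_matrixP => i j k l; rewrite tensmxE !mxE.
rewrite (inj_eq (can_inj (@mxtens_indexK n d))) xpair_eqE.
by case: (i == k); rewrite ?mul1r ?mul0r.
Qed.

(** Matrices of size 1 commute, and for proportional quadruples W G' = G W' and likewise with T, so
    only the scalar coefficients have to balance. *)
Lemma scalar_exchange (F : fieldType) (q t z w a b : F) (x : quad 'M[F]_1) :
  exchange q t z w (a *: x) (b *: x).
Proof.
have half u v c e (y : quad 'M[F]_1) : half_exchange q t u v (c *: y) (e *: y).
  by split; last split; apply/matrixP=> i j; rewrite !ord1 !mxE !big_ord1 !mxE; ring.
split; try exact: half.
  exact: (half z w a b (quad_swap x)).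
exact: (half w z b a (quad_swap x)).
Qed.

(** The series is [(1 + c z / (1 - r z)) x]; multiplication by [1 - r z] leaves degree at most
    one. *)
Lemma geometric_rational (F : fieldType) (q t r c : F) (x : quad 'M[F]_1) f :
  (forall k, f k = (if k is i.+1 then r ^+ i * c else 1) *: x) ->
  rational_exchange q t f.
Proof.
move=> fE; apply: (exchange_div (c := r) (h := fun k => f k - r *: delay f k)) => //.
pose a k := if k is i.+1 then r ^+ i * c else 1.
pose g k := a k - r * delay a k.
have hE k : f k - r *: delay f k = g k *: x.
  by rewrite /g /a scalerBl -scalerA fE; case: k => [|k] /=; rewrite ?fE ?scale0r.
apply: (exchange_poly (D := 2)) => [[|[|k]] // _|z w _].
  by rewrite hE /g /a /= exprS mulrA subrr scale0r.
have sE u : \sum_(k < 2) u ^+ k *: (f k - r *: delay f k) =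
    (\sum_(k < 2) u ^+ k * g k) *: x.
  by rewrite scaler_suml; apply: eq_bigr => k _; rewrite hE scalerA.
rewrite !sE; exact: scalar_exchange.
Qed.

Section Ops.
Variables (K : closedFieldType) (kp km : K).
Hypotheses (kp0 : kp != 0) (km0 : km != 0).
Local Notation F := (scalars K).
Local Notation q := (q K).
Local Notation qh := (qh K).

Lemma cst_neq0 (c : K) : c != 0 -> cst c != 0.
Proof. by rewrite /cst tofrac_eq0 polyC_eq0. Qed.

(* With this t, the coefficient of z^{k+1} w^0 in the fifth relation of
   half_exchange is [W_{-k}, W_1] = (Gtilde_{k+1} - G_{k+1}) / (q + q^-1). *)
Definition exchange_const : F := rho_bar kp km * (q + q^-1) / q.
Local Notation t := exchange_const.

Lemma exchange_const_neq0 : t != 0.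
Proof.
by rewrite !mulf_neq0 ?invr_neq0 ?expf_neq0 ?cst_neq0 ?q_neq0 ?qDV_neq0 ?qh_neq0.
Qed.

Definition full_seq d (f : op_family 'M[F]_d) k : quad 'M[F]_d :=
  ((Wn f k, Wp f k),
   (if k is i.+1 then Gp f i else (G0 kp km)%:M,
    if k is i.+1 then Gt f i else (G0 kp km)%:M)).

(** The last term of each recursion formula is a constant times the preceding coefficient;
    subtracting that multiple of the delay leaves [dress_seq]. *)
Lemma dress_rational n (vN : K) d (f : op_family 'M[F]_d) :
  rational_exchange q t (full_seq f) ->
  rational_exchange q t (full_seq (dress kp km n vN f)).
Proof.
pose u := cst vN : F.
(* With [a] and [b] the coefficients of S_+ and S_- in the W formulas, those in the G formulas are
   [t * a] and [t * b], and the [s] forced by the commutator of S_+ and S_- is exactly the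
   coefficient [u ^+ 2 / (q + q^-1)] of the recursion. *)
have := dress_coefficients u (cst_neq0 kp0) (cst_neq0 km0) (qh_neq0 K) (erefl q)
  (qBV_neq0 K) (qDV_neq0 K).
set a := _ / _ * _ * _; set b := _ / _ * _ * _; cbv zeta.
rewrite -[cst kp * cst km * _]/(rho_bar kp km) -[rho_bar _ _ * _ / _]/t.
move=> [sE tb ta].
have [hb hb'] := spin_half_borel n a b exchange_const_neq0.
move/(dress_seq_rational (q_neq0 K) exchange_const_neq0 (qBV_neq0 K) hb hb').
apply: exchange_div (u ^+ 2 * w0 K n / (q + q^-1) ^+ 2) _ _ _ => k.
rewrite /dress_seq /dress_coef0 /dress_coef1 sE /=.
rewrite -!scalemxAl -!mulmxA !qs3D.
rewrite !(scale_tensmx a) !(scale_tensmx b) (scalerA t b) tb (scalerA t a) ta.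
(* At index 0 the last two components are the identity tensored with the scalar G_0, which is G_0
   again on the larger space. *)
case: k => [|k] /=; congr ((_, _), (_, _)) => /=;
  rewrite ?tensmx0 ?scaler0 ?subr0 ?addr0 ?oppr0 ?tens1_scalar ?scaleNr ?addrK //.
all: by case: k => [|k] /=; rewrite addrK [RHS]addrC.
Qed.

(** With [x], [y], [d], [u] read as k_+ k_-, the product of the two epsilons, q - q^{-1} and q +
    q^{-1}, this says that the initial G_1 is [beta] times G_0. *)
Lemma init_coefficient (F : fieldType) (x y z d u : F) :
  x != 0 -> d != 0 -> u != 0 -> z = y * d ^+ 2 / (x * u ^+ 2) ->
  y * d = z * (x * u ^+ 2 / d).
Proof. by move=> x0 d0 u0 ->; field; rewrite x0 d0 u0. Qed.

Variables (ep em : K) (v : nat -> K) (twoj : nat -> nat).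

(** All four series are the same scalar series, with ratio [alpha1 / (q + q^-1)], times their
    constant terms. *)
Lemma init_rational :
  rational_exchange q t (full_seq (init_ops kp km ep em v twoj)).
Proof.
pose x : quad 'M[F]_1 := (((cst ep)%:M, (cst em)%:M), ((G0 kp km)%:M, (G0 kp km)%:M)).
apply: (@geometric_rational _ _ _ (alpha1 kp km ep em v twoj / (q + q^-1))
  (beta kp km ep em) x).
have gE : cst ep * cst em * (q - q^-1) = beta kp km ep em * G0 kp km.
  apply: init_coefficient; rewrite ?mulf_neq0 ?cst_neq0 ?qDV_neq0 ?qBV_neq0 //.
have sc (c e : F) : c *: (e%:M : 'M_1) = (c * e)%:M by rewrite scale_scalar_mx.
case=> [|k]; congr ((_, _), (_, _)); rewrite /= ?sc ?mul1r //.
  by rewrite gE mulrA.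
by rewrite gE mulrA.
Qed.

Lemma ops_rational N :
  rational_exchange q t (full_seq (ops kp km ep em v twoj N)).
Proof.
elim: N => [|N IH]; first exact: init_rational.
exact: (dress_rational (twoj N.+1) (v N.+1) IH).
Qed.

End Ops.

(** * Universal property of the presented algebra *)

Lemma map_relators (F : fieldType) (q rho : F) (A B : lalgType F)
    (f : {lrmorphism A -> B}) (X : op_family A) (Y : op_family B) k l :
  (forall m, [/\ f (Wn X m) = Wn Y m, f (Wp X m) = Wp Y m,
               f (Gp X m) = Gp Y m & f (Gt X m) = Gt Y m]) ->
  map f (relators q rho X k l) = relators q rho Y k l.
Proof.
case: X => xn xp xg xt; case: Y => yn yp yg yt /= XY.
have wn m : f (xn m) = yn m by case: (XY m).
have wp m : f (xp m) = yp m by case: (XY m).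
have gp m : f (xg m) = yg m by case: (XY m).
have gt m : f (xt m) = yt m by case: (XY m).
have fB a b : f (a - b) = f a - f b by exact: raddfB.
have fD a b : f (a + b) = f a + f b by exact: raddfD.
have fM a b : f (a * b) = f a * f b by exact: rmorphM.
have fZ c a : f (c *: a) = c *: f a by exact: linearZZ.
by rewrite /comm /qcomm /= !(fB, fD, fM, fZ) !(wn, wp, gp, gt).
Qed.

Section Presentation.
Variables (F : fieldType) (q rho : F) (B : algType F) (y : op_family B).

Definition gen_value (g : gen) : B :=
  match g with
  | gWn k => Wn y k | gWp k => Wp y k | gGp k => Gp y k | gGt k => Gt y k
  end.

Definition word_value (m : {fmonom gen}) : B := \prod_(g <- (m : seq gen)) gen_value g.

Lemma word_value_mmorphism : mmorphism word_value.
Proof.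
split=> [m1 m2|]; rewrite /word_value; last by rewrite fm1 big_nil.
by rewrite fmM big_cat.
Qed.
HB.instance Definition _ := isMultiplicative.Build _ _ word_value word_value_mmorphism.

Definition free_eval : free_alg F -> B := mmap (in_alg B) word_value.

Fact free_eval_additive : {morph free_eval : a b / a - b}.
Proof. exact: mmapB. Qed.

Fact free_eval_monoid_morphism : monoid_morphism free_eval.
Proof.
have [m e] : multiplicative free_eval.
  apply: commr_mmap_is_multiplicative => g m m'.
  by rewrite /GRing.comm /= -scalerAl -scalerAr mulr1 mul1r.
by split.
Qed.

Fact free_eval_scalable : scalable free_eval.
Proof. by move=> c a; rewrite /free_eval mmapZ /= -scalerAl mul1r. Qed.

HB.instance Definition _ :=
  GRing.isZmodMorphism.Build (free_alg F) B free_eval free_eval_additive.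
HB.instance Definition _ :=
  GRing.isMonoidMorphism.Build (free_alg F) B free_eval free_eval_monoid_morphism.
HB.instance Definition _ :=
  GRing.isScalable.Build F (free_alg F) B *:%R free_eval free_eval_scalable.

Lemma free_eval_gen g : free_eval << fmu g >> = gen_value g.
Proof. by rewrite /free_eval mmapU /= scale1r mul1r /word_value fmU big_seq1. Qed.

Lemma free_eval_relators k l :
  map free_eval (relators q rho (free_gens F) k l) = relators q rho y k l.
Proof.
apply: (map_relators q rho (f := free_eval : {lrmorphism _ -> _})) => m.
by split; exact: free_eval_gen.
Qed.

Hypothesis y_relators : forall k l, {in relators q rho y k l, forall x, x = 0}.

Definition Abar_eval (x : Abar q rho) : B := free_eval (repr x).

(** The chosen representative differs from [a] by an element of the ideal, on which evaluation
    vanishes because the relators do. *)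
Lemma Abar_eval_pi (a : free_alg F) : Abar_eval (Abar_pi q rho a) = free_eval a.
Proof.
have ideal0 b : in_ideal (is_relator q rho) b -> free_eval b = 0.
  elim=> {b} [b [k [l bkl]]||b c _ hb _ hc|b c _ hc|b c _ hc].
  - by apply: (y_relators (k := k) (l := l)); rewrite -free_eval_relators map_f.
  - exact: raddf0.
  - by rewrite raddfD /= hb hc addr0.
  - by rewrite rmorphM /= hc mulr0.
  by rewrite rmorphM /= hc mul0r.
have /asboolP/ideal0 := pi_sub_repr q rho a.
by rewrite raddfB /= => /eqP; rewrite subr_eq0 => /eqP.
Qed.

Fact Abar_eval_additive : {morph Abar_eval : a b / a - b}.
Proof.
move=> a b; elim/Abar_ind: a => a; elim/Abar_ind: b => b.
have -> : Abar_pi q rho a - Abar_pi q rho b = Abar_pi q rho (a - b).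
  by apply: (addIr (Abar_pi q rho b)); rewrite subrK Abar_piD subrK.
by rewrite !Abar_eval_pi raddfB.
Qed.

Fact Abar_eval_monoid_morphism : monoid_morphism Abar_eval.
Proof.
split; first by rewrite [LHS]Abar_eval_pi rmorph1.
move=> a b; elim/Abar_ind: a => a; elim/Abar_ind: b => b.
rewrite -[_ * _]/(Abar_mul _ _) Abar_piM !Abar_eval_pi; exact: rmorphM.
Qed.

Fact Abar_eval_scalable : scalable Abar_eval.
Proof.
move=> c a; elim/Abar_ind: a => a.
rewrite -[_ *: Abar_pi _ _ _]/(Abar_scale _ _) Abar_piZ !Abar_eval_pi; exact: linearZZ.
Qed.

Lemma Abar_universal : exists phi : {lrmorphism Abar q rho -> B},
  forall a, phi (Abar_pi q rho a) = free_eval a.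
Proof.
pose phi : {lrmorphism Abar q rho -> B} := HB.pack Abar_eval
  (GRing.isZmodMorphism.Build (Abar q rho) B Abar_eval Abar_eval_additive)
  (GRing.isMonoidMorphism.Build (Abar q rho) B Abar_eval Abar_eval_monoid_morphism)
  (GRing.isScalable.Build F (Abar q rho) B *:%R Abar_eval Abar_eval_scalable).
by exists phi => a; exact: Abar_eval_pi.
Qed.

End Presentation.

(** * From the forms on coefficients to the defining relators *)

Lemma relators_of_forms (F : fieldType) (q t rho g0 : F) d
    (X : op_family 'M[F]_d.+1) (f : nat -> quad 'M[F]_d.+1) k l :
  q != 0 -> t != 0 -> q - q^-1 != 0 -> q + q^-1 != 0 ->
  rho = g0 * (q - q^-1) -> q * t = rho * (q + q^-1) ->
  (forall k, f k = ((Wn X k, Wp X k),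
     (if k is i.+1 then Gp X i else g0%:M, if k is i.+1 then Gt X i else g0%:M))) ->
  (forall i k l, exchange_form q t i (with_delay f k) (with_delay f l) = 0 /\
    exchange_form q t i (quad_swap2 (with_delay f k))
      (quad_swap2 (with_delay f l)) = 0) ->
  {in relators q rho X k l, forall x, x = 0}.
Proof.
move=> q0 t0 dq pq rhoE qtE fE H.
have qt0 : q * t != 0 by rewrite mulf_neq0.
have q1 i a b := (H i a b).1; have q2 i a b := (H i a b).2.
have D (a c : 'M[F]_d.+1) i j : (a + c) i j = a i j + c i j by rewrite mxE.
have N (a : 'M[F]_d.+1) i j : (- a) i j = - a i j by rewrite mxE.
have S c (a : 'M[F]_d.+1) i j : (c *: a) i j = c * a i j by rewrite mxE.
have Z i j : (0 : 'M[F]_d.+1) i j = 0 by rewrite mxE.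
have use c (A R : 'M[F]_d.+1) : A = 0 -> (forall i j, R i j = c * A i j) -> R = 0.
  by move=> A0 R0; apply/matrixP=> i j; rewrite R0 A0 Z mulr0.
(* The scalar that the fourth form leaves in front of Gtilde_{k+1} - G_{k+1} when one index is 0. *)
have qtV : (q * t)^-1 * (q - q^-1) * g0 = (q + q^-1)^-1.
  rewrite qtE rhoE; have g00 : g0 != 0.
    by apply: contraNneq qt0 => g00; rewrite qtE rhoE g00 !mul0r.
  have gen (a b c : F) : a != 0 -> b != 0 -> c != 0 -> (c * a * b)^-1 * a * c = b^-1.
    by move=> a0 b0 c0; field; rewrite a0 b0 c0.
  exact: gen.
suff /allP h : all (fun x => x == 0) (relators q rho X k l).
  by move=> x /h /eqP.
case: X fE => wn wp g gt /= fE.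
rewrite /comm /qcomm -!mulmxE rhoE.
repeat (apply/andP; split); try exact: isT; apply/eqP;
  (* The delay at index 0 vanishes, which isolates W_0 or W_1 in the first six relators; the delay
     at [k.+2] reads G_{k+1} and W_{-k-1}. Here [q2] gives the relations with W and V, G and T
     exchanged. *)
  [> apply: (use (- (q * t)^-1) _ _ (q1 4 0 k.+1)%N)
  | apply: (use (q * t)^-1 _ _ (q1 4 k.+1 0)%N)
  | apply: (use (- q) _ _ (q1 2 0 k.+2)%N)
  | apply: (use q^-1 _ _ (q1 3 0 k.+2)%N)
  | apply: (use q^-1 _ _ (q2 3 0 k.+2)%N)
  | apply: (use (- q) _ _ (q2 2 0 k.+2)%N)
  | apply: (use 1 _ _ (q1 0 k l)%N)
  | apply: (use 1 _ _ (q2 0 k l)%N)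
  | apply: (use 1 _ _ (q1 5 k l)%N)
  | apply: (use 1 _ _ (q1 6 k.+1 l.+1)%N)
  | apply: (use 1 _ _ (q1 7 k.+1 l.+1)%N)
  | apply: (use 1 _ _ (q2 7 k.+1 l.+1)%N)
  | apply: (use 1 _ _ (q2 6 k.+1 l.+1)%N)
  | apply: (use 1 _ _ (q1 1 k.+1 l.+1)%N)
  | apply: (use 1 _ _ (q2 1 k.+1 l.+1)%N)
  | apply: (use 1 _ _ (q1 8 k.+1 l.+1)%N)];
  move=> i j;
  rewrite /exchange_form /quad_swap2 /quad_swap /with_delay !fE /= ?fE /=
    ?mul0mx ?mulmx0 ?mul_scalar_mx ?mul_mx_scalar ?(D, N, S, Z) -?qtV;
  field; rewrite ?q0 ?t0 //.
Qed.

(** * Surjection onto the generated subalgebra *)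

Section GeneratedImage.
Variables (F : fieldType) (q rho : F) (B : algType F) (X : op_family B).
Hypothesis X_relators : forall k l, {in relators q rho X k l, forall a, a = 0}.
Variable gens : B -> Prop.
Hypothesis gensP : forall a,
  gens a <-> exists k, [\/ a = Wn X k, a = Wp X k, a = Gp X k | a = Gt X k].

Lemma Abar_gen_subalg :
  exists phi : {lrmorphism Abar q rho -> gen_subalg gens},
    (forall k : nat,
      [/\ sval (phi (Wn (Abar_gens q rho) k)) = Wn X k,
          sval (phi (Wp (Abar_gens q rho) k)) = Wp X k,
          sval (phi (Gp (Abar_gens q rho) k)) = Gp X k
        & sval (phi (Gt (Abar_gens q rho) k)) = Gt X k])
    /\ (forall y : gen_subalg gens, exists a, phi a = y).
Proof.
have sub a : (exists k, [\/ a = Wn X k, a = Wp X k, a = Gp X k | a = Gt X k]) ->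
    subalg_pred gens a.
  by move=> h; apply/asboolP/in_subalg_gen/gensP.
pose y : op_family (gen_subalg gens) := Family
  (fun k => exist _ (Wn X k) (sub _ (ex_intro _ k (Or41 _ _ _ erefl))))
  (fun k => exist _ (Wp X k) (sub _ (ex_intro _ k (Or42 _ _ _ erefl))))
  (fun k => exist _ (Gp X k) (sub _ (ex_intro _ k (Or43 _ _ _ erefl))))
  (fun k => exist _ (Gt X k) (sub _ (ex_intro _ k (Or44 _ _ _ erefl)))).
pose sv := sval : gen_subalg gens -> B.
have svB : {morph sv : a b / a - b} by [].
have svM : monoid_morphism sv by [].
have svZ : scalable sv by [].
pose valL : {lrmorphism gen_subalg gens -> B} := HB.pack sv
  (GRing.isZmodMorphism.Build _ B sv svB)
  (GRing.isMonoidMorphism.Build _ B sv svM)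
  (GRing.isScalable.Build F _ B *:%R sv svZ).
(* The inclusion into [B] is an injective morphism, so relators may be checked in [B]. *)
have y_relators k l : {in relators q rho y k l, forall a, a = 0}.
  move=> a ya; apply: val_inj; rewrite -[LHS]/(valL a) -[RHS]/(valL 0) (raddf0 valL).
  apply: (X_relators (k := k) (l := l)).
  have <- : map valL (relators q rho y k l) = relators q rho X k l.
    by apply: map_relators => m; split.
  exact: (map_f valL ya).
have [phi phiE] := Abar_universal y_relators.
exists phi.
have phi_gens k : [/\ phi (Wn (Abar_gens q rho) k) = Wn y k,
    phi (Wp (Abar_gens q rho) k) = Wp y k,
    phi (Gp (Abar_gens q rho) k) = Gp y k
  & phi (Gt (Abar_gens q rho) k) = Gt y k].
  by split; rewrite phiE [LHS]free_eval_gen.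
split=> [k|]; first by have [-> -> -> ->] := phi_gens k.
(* Working in [B] allows induction on the generation of [a], without carrying membership proofs. *)
suff surj a : in_subalg gens a -> exists b, \val (phi b) = a.
  move=> [a pa]; have /asboolP/surj[b bE] := pa.
  by exists b; apply: val_inj.
elim=> {a} [a /gensP[k h]|||a b _ [a' <-] _ [b' <-]|c a _ [a' <-]|a b _ [a' <-] _ [b' <-]].
- have [e1 e2 e3 e4] := phi_gens k.
  case: h => ->; [exists (Wn (Abar_gens q rho) k) | exists (Wp (Abar_gens q rho) k)
    | exists (Gp (Abar_gens q rho) k) | exists (Gt (Abar_gens q rho) k)];
  by rewrite ?e1 ?e2 ?e3 ?e4.
- by exists 0; rewrite (raddf0 phi).
- by exists 1; rewrite (rmorph1 phi).
- by exists (a' + b'); rewrite (raddfD phi).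
- by exists (c *: a'); rewrite (linearZZ phi).
by exists (a' * b'); rewrite (rmorphM phi).
Qed.

End GeneratedImage.

Theorem proposition4p5 (K : closedFieldType) (charK0 : [pchar K] =i pred0)
    (N : nat) (hN : (1 <= N)%N)
    (kp km ep em : K) (hkp : kp != 0) (hkm : km != 0)
    (v : nat -> K) (hv : forall i, (1 <= i <= N)%N -> v i != 0)
    (twoj : nat -> nat) :
  let rho := rho_bar kp km in
  let A := Abar (q K) rho in
  let AN := AbarN kp km ep em v twoj N in
  let x : op_family A := Abar_gens (q K) rho in
  let X := ops kp km ep em v twoj N in
  exists phi : {lrmorphism A -> AN},
    (forall k : nat,
      [/\ sval (phi (Wn x k)) = Wn X k,
          sval (phi (Wp x k)) = Wp X k,
          sval (phi (Gp x k)) = Gp X k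
        & sval (phi (Gt x k)) = Gt X k])
    /\ (forall y : AN, exists a : A, phi a = y).
Proof.
move=> rho A AN x X.
have X_relators k l : {in relators (q K) rho X k l, forall a, a = 0}.
  apply: (relators_of_forms (q_neq0 K) (exchange_const_neq0 hkp hkm)
    (qBV_neq0 K) (qDV_neq0 K) (g0 := G0 kp km) (f := full_seq kp km X)) => //.
  (* This value of G_0 turns the term in G_0 of the third and fourth forms into [rho] times
     W_{-k-1}. *)
  - by rewrite /G0 divfK ?qBV_neq0.
  - by rewrite /exchange_const mulrC divfK ?q_neq0.
  apply: (rational_exchange_coef (@qhX_inj K));
    rewrite ?q_neq0 ?qBV_neq0 ?exchange_const_neq0 //.
  exact: ops_rational.
have [phi phiP] := Abar_gen_subalg X_relators (gens := op_gens kp km ep em v (N := N))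
  (fun a => iff_refl _).
by exists phi.
Qed.
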